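(* Let $(M,g)=(\overline M\times\Sigma,\ \overline g+\phi^2\eta)$ be a warped product of Riemannian manifolds with compact base $(\overline M,\overline g)$, fibre $(\Sigma,\eta)$ with $\dim\Sigma\ge1$, and a nonconstant warping function $\phi:\overline M\to(0,\infty)$. If $(M,g)$ has harmonic curvature, then the Einstein constant $\kappa$ of the fibre $(\Sigma,\eta)$ is positive. Consequently, $\dim\Sigma>1$, and there is no point of $M$ at which the Ricci tensor of $(M,g)$ has $n=\dim M$ distinct eigenvalues.
   Context: Manifolds are connected and smooth. A Riemannian manifold has harmonic curvature if its curvature tensor $R$ satisfies $\mathrm{div}\,R=0$, i.e. $R_{ijl}{}^k{}_{,k}=0$; equivalently, its Ricci tensor has a totally symmetric covariant derivative. It is a known fact that, when a warped product with nonconstant warping function has harmonic curvature, its fibre $(\Sigma,\eta)$ is an Einstein manifold: the Ricci tensor of $\eta$ equals $\kappa\eta$ for a constant $\kappa$, called the Einstein constant of the fibre (so $\kappa=0$ if $\dim\Sigma=1$). *)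

(* Defs.v *)
From HB Require Import structures.
From mathcomp Require Import all_boot all_order all_algebra.
From mathcomp Require Import all_classical all_reals all_analysis.

Set Implicit Arguments.
Unset Strict Implicit.
Unset Printing Implicit Defensive.
Import Order.TTheory GRing.Theory Num.Theory.
Import numFieldNormedType.Exports.

Local Open Scope classical_set_scope.
Local Open Scope ring_scope.

Definition pderiv (R : realType) (n : nat) (W : normedModType R) (i : 'I_n)
    (f : 'rV[R]_n -> W) : 'rV[R]_n -> W :=
  fun x => 'D_(delta_mx 0 i) f x.

(* C^oo: all iterated partial derivatives exist and are continuous on U.
   Only used for open U, so the values of f outside U do not matter.          *)
Definition smooth_on (R : realType) (n : nat) (W : normedModType R)
    (U : set 'rV[R]_n) (f : 'rV[R]_n -> W) : Prop :=
  forall (s : seq 'I_n) (x : 'rV[R]_n), U x ->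
    let g := foldr (fun i h => pderiv i h) f s in
    {for x, continuous g} /\ forall i : 'I_n, derivable g x (delta_mx 0 i).

(* [chart_coord] is relevant on [chart_dom] only; [chart_param], its inverse,
   on [chart_img] only. *)
Record chart (R : realType) (T : topologicalType) (n : nat) := Chart {
  chart_dom : set T;
  chart_img : set 'rV[R]_n;
  chart_coord : T -> 'rV[R]_n;
  chart_param : 'rV[R]_n -> T
}.

Definition is_chart (R : realType) (T : topologicalType) (n : nat)
    (c : chart R T n) : Prop :=
  [/\ open (chart_dom c),
      open (chart_img c),
      forall x, chart_dom c x ->
        [/\ chart_img c (chart_coord c x), chart_param c (chart_coord c x) = x
          & {for x, continuous (chart_coord c)}]
    & forall u, chart_img c u ->
        [/\ chart_dom c (chart_param c u), chart_coord c (chart_param c u) = u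
          & {for u, continuous (chart_param c)}]].

(* [gram a u] is the Gram matrix of the metric in the coordinate frame of the
   chart [chart_of a], at the point with coordinates u, for u in its [chart_img].
   The record only carries data; see [is_riemannian] for the axioms.          *)
Record riemannian (R : realType) (n : nat) := Riemannian {
  space :> topologicalType;
  chart_index : Type;
  chart_of : chart_index -> chart R space n;
  gram : chart_index -> 'rV[R]_n -> 'M[R]_n
}.

Section RiemannianManifold.
Variables (R : realType) (n : nat) (M : riemannian R n).

Definition overlap (a b : chart_index M) : set 'rV[R]_n :=
  chart_img (chart_of a) `&`
  chart_param (chart_of a) @^-1` chart_dom (chart_of b).

Definition transition (a b : chart_index M) : 'rV[R]_n -> 'rV[R]_n :=
  chart_coord (chart_of b) \o chart_param (chart_of a).

Definition is_manifold : Prop :=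
  [/\ hausdorff_space M, @second_countable M, [set: M] !=set0
    & connected [set: M]] /\
  [/\ forall a : chart_index M, is_chart (chart_of a),
      forall x : M, exists a : chart_index M, chart_dom (chart_of a) x
    & forall a b : chart_index M, smooth_on (overlap a b) (transition a b)].

(* Tangent vectors are row vectors and ['J f u] acts on them from the right,
   so the last clause is the usual tensor transformation rule.                *)
Definition is_metric : Prop :=
  [/\ forall a : chart_index M, smooth_on (chart_img (chart_of a)) (gram a),
      forall (a : chart_index M) (u : 'rV[R]_n), chart_img (chart_of a) u ->
        (gram a u)^T = gram a u,
      forall (a : chart_index M) (u : 'rV[R]_n), chart_img (chart_of a) u ->
        forall v : 'rV[R]_n, v != 0 -> 0 < (v *m gram a u *m v^T) 0 0
    & forall (a b : chart_index M) (u : 'rV[R]_n), overlap a b u ->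
        let J := 'J (transition a b) u in
        gram a u = J *m gram b (transition a b u) *m J^T].

Definition is_riemannian : Prop := is_manifold /\ is_metric.

Definition smooth_fun (f : M -> R) : Prop :=
  forall a : chart_index M,
    smooth_on (chart_img (chart_of a)) (f \o chart_param (chart_of a)).

End RiemannianManifold.

Section Curvature.
Variables (R : realType) (n : nat) (g : 'rV[R]_n -> 'M[R]_n).
Implicit Types (i j k l q : 'I_n) (x : 'rV[R]_n).

(* Gamma_ij^k *)
Definition christoffel i j k x : R :=
  2^-1 * \sum_l invmx (g x) k l *
    (pderiv i (fun y => g y j l) x + pderiv j (fun y => g y i l) x
     - pderiv l (fun y => g y i j) x).

(* R_ijl^k, with the sign convention R_ij = R_ikj^k for the Ricci tensor; thus
   R(u,v)w = D_v D_u w - D_u D_v w + D_[u,v] w.                               *)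
Definition riemann i j l k x : R :=
  pderiv j (christoffel i l k) x - pderiv i (christoffel j l k) x
  + \sum_q (christoffel j q k x * christoffel i l q x
            - christoffel i q k x * christoffel j l q x).

Definition ricci x : 'M[R]_n := \matrix_(i, j) \sum_k riemann i k j k x.

(* R_ijl^k_,h *)
Definition cov_riemann i j l k h x : R :=
  pderiv h (riemann i j l k) x
  - \sum_q christoffel h i q x * riemann q j l k x
  - \sum_q christoffel h j q x * riemann i q l k x
  - \sum_q christoffel h l q x * riemann i j q k x
  + \sum_q christoffel h q k x * riemann i j l q x.

(* R_ijl^k_,k *)
Definition div_riemann i j l x : R := \sum_k cov_riemann i j l k k x.

(* For row vectors v, v *m ricci_endo x is the image of v under the Ricci
   tensor viewed as an endomorphism of the tangent space (R_i^k).             *)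
Definition ricci_endo x : 'M[R]_n := ricci x *m invmx (g x).

End Curvature.

Definition harmonic_curvature (R : realType) (n : nat) (M : riemannian R n) :
    Prop :=
  forall (a : chart_index M) (u : 'rV[R]_n), chart_img (chart_of a) u ->
    forall i j l : 'I_n, div_riemann (gram a) i j l u = 0.

Definition einstein_constant (R : realType) (n : nat) (M : riemannian R n)
    (kappa : R) : Prop :=
  forall (a : chart_index M) (u : 'rV[R]_n), chart_img (chart_of a) u ->
    ricci (gram a) u = kappa *: gram a u.

(* The eigenvalues do not depend on the chart around x, so any chart will do.  *)
Definition ricci_distinct_at (R : realType) (n : nat) (M : riemannian R n)
    (x : M) : Prop :=
  exists2 a : chart_index M, chart_dom (chart_of a) x &
    exists s : n.-tuple R,
      uniq s /\
      all (eigenvalue (ricci_endo (gram a) (chart_coord (chart_of a) x))) s.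

Definition prod_chart (R : realType) (B F : topologicalType) (m p : nat)
    (c : chart R B m) (d : chart R F p) : chart R (B * F)%type (m + p) :=
  Chart (chart_dom c `*` chart_dom d)
        [set u | chart_img c (lsubmx u) /\ chart_img d (rsubmx u)]
        (fun z => row_mx (chart_coord c z.1) (chart_coord d z.2))
        (fun u => (chart_param c (lsubmx u), chart_param d (rsubmx u))).

Definition warped_product (R : realType) (m p : nat) (B : riemannian R m)
    (F : riemannian R p) (phi : B -> R) : riemannian R (m + p) :=
  @Riemannian R (m + p) (B * F)%type (chart_index B * chart_index F)%type
    (fun a => prod_chart (chart_of a.1) (chart_of a.2))
    (fun a u =>
       block_mx (gram a.1 (lsubmx u)) 0
                0 (phi (chart_param (chart_of a.1) (lsubmx u)) ^+ 2
                     *: gram a.2 (rsubmx u))).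

Arguments warped_product {R m p} B F phi.

(* Main.v *)
(* With Q = |grad phi|^2, the mixed component (base, fibre, fibre) of div R = 0
   on the warped product reads, tensorially in the fibre metric eta,
     phi_i Ric(eta) = eta ((p-1) Q phi_i - phi^2 phi_ih^h - (p-2) phi phi_ih phi^h).
   At a point with d phi <> 0 this makes the fibre Einstein, with constant kappa,
   and contracting with grad phi turns it into the Bochner-type identity
     (1/2) (Delta Q + (p-2) <grad phi, grad Q> / phi)
       = |Hess phi|^2 + ((p-1) Q^2 - kappa Q) / phi^2.
   If kappa <= 0, the right-hand side is nonnegative, which for p >= 2 is
   impossible at a maximum of Q.  To include p = 1 without a strong maximum
   principle, Q is replaced by Q (C + phi^3) with a large constant C: the weight
   contributes strictly positive first-order terms, and the term in Delta phi
   is absorbed by |Hess phi|^2 through tr (Hess + c)^2 >= 0.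
   As kappa = 0 when p = 1, positivity forces p >= 2; the Ricci endomorphism is
   then block triangular with a scalar p x p block, hence has at most m + 1
   distinct eigenvalues.                                                      *)
From HB Require Import structures.
Require Import Defs.
From mathcomp Require Import all_boot all_order all_algebra.
From mathcomp Require Import all_classical all_reals all_analysis.
From mathcomp Require Import ring lra.

Set Implicit Arguments.
Unset Strict Implicit.
Unset Printing Implicit Defensive.
Import Order.TTheory GRing.Theory Num.Theory.
Import numFieldNormedType.Exports.
Local Open Scope classical_set_scope.
Local Open Scope ring_scope.

(** * Smooth functions of several variables *)

(** The third derivatives phi_ih^h in the harmonic curvature equation are the divergence of the
    Hessian, with derivatives in the very order produced by differentiating grad Q = 2 Hess(grad
    phi). The Bochner-type identity thus arises without commuting derivatives, and no curvature of
    the base enters. For p = 1 and kappa = 0, a maximum of Q only yields Hess phi = 0 at that point,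
    hence the weight. With psi = C + phi^k, the condition d(Q psi) = 0 gives 2 psi Hess(grad phi,
    grad phi) = -k phi^(k-1) Q^2, and the terms of Delta(Q psi) in phi^(k-2) Q^2 add up to the
    coefficient k(k-1) + k(p-2) = k(k+p-3). The least positive integer k making this positive at p =
    1 is 3, where it equals 3p. Two negative terms remain: 18 phi^4 Q^2 / psi from the product of
    grad psi and grad Q, and (9m/8) phi^4 Q^2 / psi from absorbing Delta phi. They are dominated
    once psi > (6 + 3m/8) phi^3, which is the bound imposed on C. *)

Lemma near_eq_continuous (X Y : topologicalType) (F G : X -> Y) (x : X) :
  {near x, F =1 G} -> {for x, continuous F} -> {for x, continuous G}.
Proof.
move=> FG cF; have e : F x = G x := nbhs_singleton FG.
change (G @ x --> G x); rewrite -e => P /= /cF.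
by apply: filterS2 FG => y /= ->.
Qed.

Section SmoothFunctions.
Variables (R : realType) (n : nat).
Implicit Types (U : set 'rV[R]_n) (f g : 'rV[R]_n -> R) (x : 'rV[R]_n).

(** Unlike [smooth_on], this peels off the innermost derivative and grades by order, so that closure
    under products and inverses goes by induction on [k]. *)
Fixpoint Ck (W : normedModType R) U (k : nat) (f : 'rV[R]_n -> W) : Prop :=
  (forall x, U x -> {for x, continuous f}) /\
  if k is k'.+1 then forall i : 'I_n,
    (forall x, U x -> derivable f x (delta_mx 0 i)) /\ Ck U k' (pderiv i f)
  else True.

Definition Cinf (W : normedModType R) U (f : 'rV[R]_n -> W) :=
  forall k, Ck U k f.

Section Vector.
Variable W : normedModType R.
Implicit Types F G : 'rV[R]_n -> W.

Lemma smooth_on_Cinf U F : smooth_on U F -> Cinf U F.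
Proof.
move=> sF k; elim: k F sF => [|k IH] F sF; split => //.
- by move=> x Ux; exact: (sF [::] x Ux).1.
- by move=> x Ux; exact: (sF [::] x Ux).1.
move=> i; split; first by move=> x Ux; exact: (sF [::] x Ux).2 i.
(* [foldr] applies the last index first, so the innermost derivative is appended at the end. *)
by apply: IH => s x Ux; have := sF (rcons s i) x Ux; rewrite foldr_rcons.
Qed.

Lemma pderiv_ext U F G i x : open U -> U x -> (forall y, U y -> F y = G y) ->
  pderiv i F x = pderiv i G x.
Proof.
move=> oU Ux FG; apply: near_eq_derive; near=> y; apply: FG; near: y.
exact: open_nbhs_nbhs.
Unshelve. all: by end_near. Qed.

Lemma Ck_ext U k F G : open U -> (forall y, U y -> F y = G y) ->
  Ck U k F -> Ck U k G.
Proof.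
move=> oU; elim: k F G => [|k IH] F G FG [cF dF];
  have nFG x : U x -> {near x, F =1 G}.
- by move=> Ux; near=> y; apply: FG; near: y; exact: open_nbhs_nbhs.
- by split=> // x Ux; apply: near_eq_continuous (nFG x Ux) _; exact: cF.
- by move=> Ux; near=> y; apply: FG; near: y; exact: open_nbhs_nbhs.
split=> [x Ux|i]; first by apply: near_eq_continuous (nFG x Ux) _; exact: cF.
split=> [x Ux|].
  by apply: near_eq_derivable (nFG x Ux) _; exact: (dF i).1.
apply: (IH (pderiv i F)); last exact: (dF i).2.
by move=> y Uy; exact: (pderiv_ext i oU Uy FG).
Unshelve. all: by end_near. Qed.

Lemma Ck_pred U k F : Ck U k.+1 F -> Ck U k F.
Proof.
elim: k F => [|k IH] F [cF dF]; split => // i; split; first exact: (dF i).1.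
by apply: IH; exact: (dF i).2.
Qed.

Lemma Cinf_ext U F G : open U -> (forall y, U y -> F y = G y) ->
  Cinf U F -> Cinf U G.
Proof. by move=> oU FG sF k; exact: Ck_ext (sF k). Qed.

Lemma Cinf_continuous U F x : Cinf U F -> U x -> {for x, continuous F}.
Proof. by move=> sF; exact: (sF 0%N).1. Qed.

Lemma Cinf_derivable U F i x : Cinf U F -> U x ->
  derivable F x (delta_mx 0 i).
Proof. by move=> sF; exact: ((sF 1%N).2 i).1. Qed.

Lemma Cinf_pderiv U F i : Cinf U F -> Cinf U (pderiv i F).
Proof. by move=> sF k; exact: ((sF k.+1).2 i).2. Qed.

End Vector.

Lemma Cinf_mx a b U (F : 'rV[R]_n -> 'M[R]_(a, b)) i j : open U ->
  Cinf U F -> Cinf U (fun x => F x i j).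
Proof.
move=> oU sF k; move: (sF k) => {sF}; elim: k F => [|k IH] F [cF dF].
  split=> // x Ux; apply: (@continuous_comp _ _ _ F (fun M => M i j)).
    exact: cF.
  exact: coord_continuous.
split=> [x Ux|l].
  apply: (@continuous_comp _ _ _ F (fun M => M i j)); first exact: cF.
  exact: coord_continuous.
split=> [x Ux|].
  by have /derivable_mxP := (dF l).1 x Ux; exact.
apply: Ck_ext (IH _ (dF l).2) => // y Uy.
by rewrite /pderiv derive_mx ?mxE//; exact: (dF l).1.
Qed.

Lemma pderivD f g i x : derivable f x (delta_mx 0 i) ->
  derivable g x (delta_mx 0 i) ->
  pderiv i (fun y => f y + g y) x = pderiv i f x + pderiv i g x.
Proof. exact: deriveD. Qed.

Lemma pderivN f i x : derivable f x (delta_mx 0 i) ->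
  pderiv i (fun y => - f y) x = - pderiv i f x.
Proof. exact: deriveN. Qed.

Lemma pderivM f g i x : derivable f x (delta_mx 0 i) ->
  derivable g x (delta_mx 0 i) ->
  pderiv i (fun y => f y * g y) x = pderiv i f x * g x + f x * pderiv i g x.
Proof.
by move=> df dg; rewrite /pderiv deriveM// addrC [_ *: _]mulrC.
Qed.

Lemma pderivX f k i x : derivable f x (delta_mx 0 i) ->
  pderiv i (fun y => f y ^+ k.+1) x = k.+1%:R * f x ^+ k * pderiv i f x.
Proof.
move=> df; rewrite /pderiv (_ : (fun y => f y ^+ k.+1) = f ^+ k.+1).
  by rewrite deriveX.
by apply/funext => y; rewrite exprfctE.
Qed.

Lemma pderivV f i x : f x != 0 -> derivable f x (delta_mx 0 i) ->
  pderiv i (fun y => (f y)^-1) x = - (pderiv i f x * (f x)^-1 * (f x)^-1).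
Proof.
move=> fx0 df; rewrite /pderiv deriveV//= scaleNr /GRing.scale/=.
by rewrite expr2 invfM mulrC mulrA.
Qed.

Lemma pderiv_cst (c : R) i x : pderiv i (fun=> c) x = 0.
Proof. exact: derive_cst. Qed.

Lemma Ck_cst U k (c : R) : open U -> Ck U k (fun=> c).
Proof.
move=> oU; have cc (a : R) x : U x -> {for x, continuous (fun=> a : R)}.
  by move=> _; apply: cst_continuous.
elim: k c => [|k IH] c; split=> //; [exact: cc..|].
move=> i; split=> [x _|]; first exact: derivable_cst.
by apply: Ck_ext (IH 0) => // y _; rewrite pderiv_cst.
Qed.

Lemma CkD U k f g : open U -> Ck U k f -> Ck U k g ->
  Ck U k (fun x => f x + g x).
Proof.
move=> oU; elim: k f g => [|k IH] f g [cf df] [cg dg].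
  by split=> // x Ux; apply: continuousD; [exact: cf|exact: cg].
split=> [x Ux|i]; first by apply: continuousD; [exact: cf|exact: cg].
split=> [x Ux|]; first by apply: derivableD; [exact: (df i).1|exact: (dg i).1].
apply: Ck_ext (IH _ _ (df i).2 (dg i).2) => // y Uy.
by rewrite pderivD//; [exact: (df i).1|exact: (dg i).1].
Qed.

Lemma CkM U k f g : open U -> Ck U k f -> Ck U k g ->
  Ck U k (fun x => f x * g x).
Proof.
move=> oU; elim: k f g => [|k IH] f g sf sg; have [cf df] := sf;
    have [cg dg] := sg.
  by split=> // x Ux; apply: continuousM; [exact: cf|exact: cg].
split=> [x Ux|i]; first by apply: continuousM; [exact: cf|exact: cg].
split=> [x Ux|]; first by apply: derivableM; [exact: (df i).1|exact: (dg i).1].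
apply: (@Ck_ext _ U k (fun x => pderiv i f x * g x + f x * pderiv i g x)) => //.
  by move=> y Uy; rewrite pderivM//; [exact: (df i).1|exact: (dg i).1].
by apply: CkD => //; apply: IH => //;
  [exact: (df i).2|exact: Ck_pred|exact: Ck_pred|exact: (dg i).2].
Qed.

Lemma CkN U k f : open U -> Ck U k f -> Ck U k (fun x => - f x).
Proof.
move=> oU sf; have := CkM oU (Ck_cst k (-1) oU) sf.
by apply: Ck_ext => // y _; rewrite mulN1r.
Qed.

(** The derivative of 1/f contains 1/f again, but only to order [k], where the induction hypothesis
    covers it. *)
Lemma CkV U k f : open U -> (forall x, U x -> f x != 0) -> Ck U k f ->
  Ck U k (fun x => (f x)^-1).
Proof.
move=> oU f0; elim: k => [|k IH] sf; have [cf df] := sf.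
  by split=> // x Ux; apply: continuousV; [exact: f0|exact: cf].
split=> [x Ux|i]; first by apply: continuousV; [exact: f0|exact: cf].
split=> [x Ux|]; first by apply: derivableV; [exact: f0|exact: (df i).1].
have sV := IH (Ck_pred sf).
apply: (@Ck_ext _ U k (fun x => - (pderiv i f x * (f x)^-1 * (f x)^-1))) => //.
  by move=> y Uy; rewrite pderivV//; [exact: f0|exact: (df i).1].
by apply: CkN => //; apply: CkM => //; apply: CkM => //; exact: (df i).2.
Qed.

Lemma Cinf_cst U (c : R) : open U -> Cinf U (fun=> c).
Proof. by move=> oU k; exact: Ck_cst. Qed.

Lemma CinfD U f g : open U -> Cinf U f -> Cinf U g ->
  Cinf U (fun x => f x + g x).
Proof. by move=> oU sf sg k; exact: CkD. Qed.

Lemma CinfM U f g : open U -> Cinf U f -> Cinf U g ->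
  Cinf U (fun x => f x * g x).
Proof. by move=> oU sf sg k; exact: CkM. Qed.

Lemma CinfN U f : open U -> Cinf U f -> Cinf U (fun x => - f x).
Proof. by move=> oU sf k; exact: CkN. Qed.

Lemma CinfB U f g : open U -> Cinf U f -> Cinf U g ->
  Cinf U (fun x => f x - g x).
Proof. by move=> oU sf sg; apply: CinfD => //; exact: CinfN. Qed.

Lemma CinfV U f : open U -> (forall x, U x -> f x != 0) -> Cinf U f ->
  Cinf U (fun x => (f x)^-1).
Proof. by move=> oU f0 sf k; exact: CkV. Qed.

Lemma CinfX U f k : open U -> Cinf U f -> Cinf U (fun x => f x ^+ k).
Proof.
move=> oU sf; elim: k => [|k IH].
  by apply: Cinf_ext (Cinf_cst 1 oU) => // y _; rewrite expr0.
by apply: Cinf_ext (CinfM oU sf IH) => // y _; rewrite exprS.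
Qed.

Lemma Cinf_sum U (I : Type) (s : seq I) (P : pred I)
    (F : I -> 'rV[R]_n -> R) : open U -> (forall i, Cinf U (F i)) ->
  Cinf U (fun x => \sum_(i <- s | P i) F i x).
Proof.
move=> oU sF; elim: s => [|i s IH].
  by apply: Cinf_ext (Cinf_cst 0 oU) => // y _; rewrite big_nil.
case Pi: (P i); last by apply: Cinf_ext IH => // y _; rewrite big_cons Pi.
by apply: Cinf_ext (CinfD oU (sF i) IH) => // y _; rewrite big_cons Pi.
Qed.

Lemma Cinf_prod U (I : Type) (s : seq I) (P : pred I)
    (F : I -> 'rV[R]_n -> R) : open U -> (forall i, Cinf U (F i)) ->
  Cinf U (fun x => \prod_(i <- s | P i) F i x).
Proof.
move=> oU sF; elim: s => [|i s IH].
  by apply: Cinf_ext (Cinf_cst 1 oU) => // y _; rewrite big_nil.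
case Pi: (P i); last by apply: Cinf_ext IH => // y _; rewrite big_cons Pi.
by apply: Cinf_ext (CinfM oU (sF i) IH) => // y _; rewrite big_cons Pi.
Qed.

Lemma pderiv_sum U (I : Type) (s : seq I) (P : pred I)
    (F : I -> 'rV[R]_n -> R) i x : open U -> U x -> (forall k, Cinf U (F k)) ->
  pderiv i (fun y => \sum_(k <- s | P k) F k y) x =
  \sum_(k <- s | P k) pderiv i (F k) x.
Proof.
move=> oU Ux sF; elim: s => [|k s IH].
  rewrite big_nil (_ : (fun _ => _) = fun=> 0) ?pderiv_cst//.
  by apply/funext => y; rewrite big_nil.
rewrite big_cons; case: ifP => Pk; last first.
  by rewrite -IH; congr pderiv; apply/funext => y; rewrite big_cons Pk.
rewrite -IH -pderivD; last 2 first.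
- exact: Cinf_derivable (sF k) Ux.
- by apply: Cinf_derivable Ux; exact: Cinf_sum.
by congr pderiv; apply/funext => y; rewrite big_cons Pk.
Qed.

Lemma Cinf_det U k (F : 'rV[R]_n -> 'M[R]_k) : open U ->
  (forall i j, Cinf U (fun x => F x i j)) -> Cinf U (fun x => \det (F x)).
Proof.
move=> oU sF; apply: Cinf_sum => // s; apply: CinfM => //; first exact: Cinf_cst.
by apply: Cinf_prod.
Qed.

(** By Cramer's rule the entries are polynomials in those of [F] divided by the determinant. *)
Lemma Cinf_invmx U k (F : 'rV[R]_n -> 'M[R]_k) i j : open U ->
  (forall x, U x -> F x \in unitmx) ->
  (forall i j, Cinf U (fun x => F x i j)) -> Cinf U (fun x => invmx (F x) i j).
Proof.
move=> oU uF sF.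
apply: (@Cinf_ext _ U (fun x => (\det (F x))^-1 * \adj (F x) i j)) => //.
  by move=> x Ux; rewrite /invmx uF// !mxE.
apply: CinfM => //.
  apply: CinfV => //; last exact: Cinf_det.
  by move=> x Ux; have := uF x Ux; rewrite unitmxE unitfE.
apply: (@Cinf_ext _ U (fun x => cofactor (F x) j i)) => //.
  by move=> x _; rewrite !mxE.
apply: CinfM => //; first exact: Cinf_cst.
apply: Cinf_det => // a b; apply: Cinf_ext (sF (lift j a) (lift i b)) => //.
by move=> x _; rewrite !mxE.
Qed.

End SmoothFunctions.

(** * Differentiability, symmetry of second derivatives, and interior maxima *)

Section SeveralVariables.
Variables (R : realType) (n : nat).
Implicit Types (U : set 'rV[R]_n) (f g : 'rV[R]_n -> R) (x y v : 'rV[R]_n).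

Lemma is_derive_line f y v t : derivable f (y + t *: v) v ->
  is_derive t 1 (fun s : R => f (y + s *: v)) ('D_v f (y + t *: v)).
Proof.
move=> df.
have e : (fun h : R => h^-1 *: (((fun s => f (y + s *: v)) \o shift t)
      (h *: (1 : R)) - f (y + t *: v))) =
    (fun h => h^-1 *: ((f \o shift (y + t *: v)) (h *: v) - f (y + t *: v))).
  apply/funext => h /=; congr (_ *: (f _ - _)).
  by rewrite [h%:A]mulr1 scalerDl addrCA.
apply: DeriveDef; first by rewrite /derivable /= e.
by rewrite /derive /= e.
Qed.

Lemma MVT_line f y v (a b : R) : a < b ->
  (forall t, a <= t <= b -> derivable f (y + t *: v) v) ->
  exists2 t, a < t < b &
    f (y + b *: v) - f (y + a *: v) = (b - a) * 'D_v f (y + t *: v).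
Proof.
move=> ab df.
have d t : a <= t <= b ->
    is_derive t 1 (fun s : R => f (y + s *: v)) ('D_v f (y + t *: v)).
  by move=> /df; exact: is_derive_line.
have dI t : t \in `]a, b[ ->
    is_derive t 1 (fun s : R => f (y + s *: v)) ('D_v f (y + t *: v)).
  by rewrite in_itv/= => /andP[/ltW ? /ltW ?]; apply: d; apply/andP.
have cI : {within `[a, b], continuous (fun s : R => f (y + s *: v))}.
  apply: derivable_within_continuous => t; rewrite in_itv/= => tab.
  exact: (@ex_derive _ _ _ _ _ _ _ (d t tab)).
have [t] := MVT ab dI cI.
rewrite in_itv/= => tab e.
by exists t => //; rewrite e mulrC.
Qed.

(** The increment [s] may have either sign or vanish, as the coordinates of a displacement do. *)
Lemma MVT_line_sym f y v (s : R) :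
  (forall t, `|t| <= `|s| -> derivable f (y + t *: v) v) ->
  exists2 t, `|t| <= `|s| &
    f (y + s *: v) - f y = s * 'D_v f (y + t *: v).
Proof.
move=> df; have [s0|s0|->] := ltgtP s 0; last first.
- by exists 0; rewrite // scale0r addr0 subrr mul0r.
- have [|t /andP[t1 t2]] := @MVT_line f y v 0 s s0.
    move=> t /andP[t0 ts]; apply: df; rewrite !ger0_norm//.
    exact: le_trans ts.
  rewrite scale0r addr0 subr0 => e; exists t => //.
  by rewrite !ger0_norm// ltW// (lt_trans t1).
have [|t /andP[t1 t2]] := @MVT_line f y v s 0 s0.
  move=> t /andP[t0 ts]; apply: df; rewrite !ler0_norm ?lerN2//.
  exact: ltW.
rewrite scale0r addr0 sub0r => e; exists t => //.
  by rewrite !ler0_norm ?lerN2// ltW.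
by rewrite -opprB e mulNr opprK.
Qed.

Lemma norm_row_le (h : 'rV[R]_n) (e : R) : 0 <= e ->
  (forall i, `|h 0 i| <= e) -> `|h| <= e.
Proof.
move=> e0 he; rewrite [`|h|]/Num.norm/= mx_normrE.
by apply: (big_ind (fun a => a <= e)) => // [a b|[i j] _ /=];
  [rewrite ge_max => -> ->|rewrite ord1].
Qed.

Lemma row_coord_le (h : 'rV[R]_n) i : `|h 0 i| <= `|h|.
Proof.
rewrite [`|h|]/Num.norm/= mx_normrE.
exact: (le_bigmax _ (fun i : 'I_1 * 'I_n => `|h i.1 i.2|) (0, i)).
Qed.

Lemma norm_delta_le (t : R) (i : 'I_n) :
  `|t *: (delta_mx 0 i : 'rV[R]_n)| <= `|t|.
Proof.
apply: norm_row_le => // j; rewrite !mxE.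
by case: (_ && _); rewrite ?mulr1// mulr0 normr0.
Qed.

(** One step of the staircase from 0 to [h] that switches on the coordinates one at a time. *)
Lemma row_trunc_step (h : 'rV[R]_n) (k : 'I_n) :
  \row_j (if (j < k.+1)%N then h 0 j else 0) =
  \row_j (if (j < k)%N then h 0 j else 0) + h 0 k *: delta_mx 0 k
  :> 'rV[R]_n.
Proof.
apply/rowP => j; rewrite !mxE eqxx/= ltnS leq_eqVlt.
rewrite -[nat_of_ord j == k]/(j == k).
by case: eqVneq => [->|_] /=; rewrite ?ltnn ?add0r ?mulr1// mulr0 addr0.
Qed.

(** In the sup norm the staircase never leaves the ball of radius |h|, so derivative bounds on that
    ball apply along it. *)
Lemma row_trunc_norm (h : 'rV[R]_n) k (t : R) (i : 'I_n) : `|t| <= `|h 0 i| ->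
  (k <= i)%N ->
  `|\row_j (if (j < k)%N then h 0 j else 0) + t *: delta_mx 0 i| <= `|h|.
Proof.
move=> ti ki; apply: norm_row_le => // j; rewrite !mxE eqxx/=.
case: eqVneq => [->|_]; last first.
  by rewrite mulr0 addr0; case: ifP => _; rewrite ?normr0// row_coord_le.
rewrite ltnNge ki/= add0r mulr1.
by apply: le_trans ti _; exact: row_coord_le.
Qed.

Lemma nbhs_rowP x (P : set 'rV[R]_n) : nbhs x P ->
  exists2 e : R, 0 < e & forall y, `|y - x| < e -> P y.
Proof.
move=> /nbhs_ballP[e /= e0 eP]; exists e => // y yx; apply: eP.
by rewrite -ball_normE/= -opprB normrN.
Qed.

Lemma C1_increment U f x (e : R) : open U -> U x -> Ck U 1 f -> 0 < e ->
  exists2 d : R, 0 < d & forall h, `|h| < d ->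
    `|f (x + h) - f x - \sum_i h 0 i * pderiv i f x| <= e * `|h|.
Proof.
(* Each of the [n] steps costs [e' * |h|]; the successor avoids a division by zero for n = 0. *)
move=> oU Ux sf e0; pose e' := e / n.+1%:R.
have e'0 : 0 < e' by rewrite divr_gt0.
have : \forall y \near x, U y /\
    forall i : 'I_n, `|pderiv i f x - pderiv i f y| <= e'.
  near=> y; split; first by near: y; exact: open_nbhs_nbhs.
  near: y; apply: filter_forall => i.
  have /= := (sf.2 i).2.1 x Ux.
  by move=> /cvgrPdist_le/(_ _ e'0).
move=> /nbhs_rowP[d d0 dP]; exists d => // h hd.
pose tr k : 'rV[R]_n := \row_j (if (j < k)%N then h 0 j else 0).
have tr0 : tr 0%N = 0 by apply/rowP => j; rewrite !mxE.
have trn : tr n = h by apply/rowP => j; rewrite !mxE ltn_ord.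
have -> : f (x + h) - f x =
    \sum_(k < n) (f (x + tr k.+1) - f (x + tr k)).
  rewrite -(big_mkord xpredT (fun k => f (x + tr k.+1) - f (x + tr k))).
  by rewrite telescope_sumr// tr0 trn addr0.
rewrite -sumrB.
have step (k : 'I_n) : `|f (x + tr k.+1) - f (x + tr k)
    - h 0 k * pderiv k f x| <= e' * `|h|.
  have near_in t : `|t| <= `|h 0 k| ->
      `|x + tr k + t *: delta_mx 0 k - x| < d.
    move=> tk; rewrite -(addrA x) [X in `|X|]addrC addKr.
    by apply: le_lt_trans hd; exact: row_trunc_norm.
  have [|t tk] := @MVT_line_sym f (x + tr k) (delta_mx 0 k) (h 0 k) _.
    by move=> t tk; apply: (sf.2 k).1; exact: (dP _ (near_in t tk)).1.
  rewrite [tr k.+1]row_trunc_step addrA => ->.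
  rewrite -mulrBr normrM mulrC ler_pM//; last exact: row_coord_le.
  by rewrite distrC; exact: (dP _ (near_in t tk)).2.
apply: le_trans (ler_norm_sum _ _ _) _.
apply: (@le_trans _ _ (\sum_(k < n) e' * `|h|)); first exact: ler_sum.
rewrite sumr_const card_ord -mulr_natr mulrAC ler_wpM2r// /e'.
by rewrite mulrAC ler_pdivrMr// ler_wpM2l ?ler_nat// ltW.
Unshelve. all: by end_near. Qed.

Lemma C1_diff U f x : open U -> U x -> Ck U 1 f -> differentiable f x /\
  forall v, 'd f x v = \sum_i v 0 i * pderiv i f x.
Proof.
move=> oU Ux sf.
pose df (v : 'rV[R]_n) : R := \sum_i v 0 i * pderiv i f x.
have ldf : linear df.
  move=> a u v; rewrite /df scaler_sumr -big_split/=; apply: eq_bigr => i _.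
  by rewrite !mxE mulrDl -mulrA.
pose L : {linear 'rV[R]_n -> R} :=
  HB.pack df (GRing.isLinear.Build R _ _ _ df ldf).
have cL : continuous L.
  move=> v; apply: (@differentiable_continuous _ _ _ v df).
  have -> : df = \sum_i (fun v : 'rV[R]_n => v 0 i * pderiv i f x).
    by apply/funext => u; rewrite fct_sumE.
  apply: differentiable_sum => i.
  by apply: differentiableM => //; exact: differentiable_coord.
(* The differential is a chosen linear map, so it is first identified by uniqueness; the same
   estimate then gives differentiability. *)
have eD : 'd f x = L :> ('rV[R]_n -> R).
  apply: (@diff_unique R 'rV[R]_n R f L x cL).
  apply/(@eqaddoP R 'rV[R]_n R 'rV[R]_n) => e e0.
  have [d d0 dP] := C1_increment oU Ux sf e0.
  near=> h; change (`|f (h + x) - (f x + df h)| <= e * `|h|).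
  rewrite opprD addrA [h + x]addrC; apply: dP; near: h.
  apply/nbhs_ballP; exists d => //= h.
  by rewrite -ball_normE/= sub0r normrN.
split; last by move=> v; rewrite eD.
apply/diff_locallyP; rewrite eD; split; first exact: cL.
apply/(@eqaddoP R 'rV[R]_n R 'rV[R]_n) => e e0.
have [d d0 dP] := C1_increment oU Ux sf e0.
near=> h; change (`|f (h + x) - (f x + df h)| <= e * `|h|).
rewrite opprD addrA [h + x]addrC; apply: dP; near: h.
  apply/nbhs_ballP; exists d => //= h.
  by rewrite -ball_normE/= sub0r normrN.
Unshelve. all: by end_near. Qed.

Lemma deriveE_pderiv U f x v : open U -> U x -> Ck U 1 f ->
  derivable f x v /\ 'D_v f x = \sum_i v 0 i * pderiv i f x.
Proof.
move=> oU Ux sf; have [df dE] := C1_diff oU Ux sf.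
by rewrite deriveE// dE; split=> //; exact: diff_derivable.
Qed.

Lemma ball_line U x v : open U -> U x ->
  exists2 d : R, 0 < d & forall t, `|t| < d -> U (x + t *: v).
Proof.
move=> oU Ux; have /nbhs_rowP[e e0 eP] : nbhs x U by exact: open_nbhs_nbhs.
(* Adding 1 covers v = 0. *)
exists (e / (`|v| + 1)); first by rewrite divr_gt0// ltr_wpDl.
move=> t; rewrite ltr_pdivlMr ?ltr_wpDl// => te; apply: eP.
rewrite [x + _]addrC addrK normrZ; apply: le_lt_trans te.
by rewrite ler_wpM2l// lerDl.
Qed.

(** The mean value theorem, used along [i] for the increment in direction [j] and then along [j],
    turns the second difference over a rectangle into s t times the mixed derivative at a point of a
    slightly larger box, where it is close to its value at [x]. *)
Lemma pderiv_pderivC_near U f x (i j : 'I_n) (e : R) :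
  open U -> U x -> Cinf U f -> 0 < e -> exists2 d : R, 0 < d &
  forall s t : R, 0 < s < d -> 0 < t < d ->
  `|f (x + s *: delta_mx 0 i + t *: delta_mx 0 j) - f (x + s *: delta_mx 0 i)
    - (f (x + t *: delta_mx 0 j) - f x)
    - s * t * pderiv j (pderiv i f) x| <= s * t * e.
Proof.
move=> oU Ux sf e0; pose ei : 'rV[R]_n := delta_mx 0 i.
pose ej : 'rV[R]_n := delta_mx 0 j.
have : \forall y \near x, U y /\
    `|pderiv j (pderiv i f) x - pderiv j (pderiv i f) y| <= e.
  near=> y; split; first by near: y; exact: open_nbhs_nbhs.
  near: y; have /= := Cinf_continuous (Cinf_pderiv j (Cinf_pderiv i sf)) Ux.
  by move=> /cvgrPdist_le/(_ _ e0).
(* Displacements along both sides add up, so each gets half of the radius. *)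
move=> /nbhs_rowP[d d0 dP]; exists (d / 2); first by rewrite divr_gt0.
move=> s t /andP[s0 sd] /andP[t0 td].
have inU a b : `|a| <= `|s| -> `|b| <= `|t| ->
    `|x + a *: ei + b *: ej - x| < d.
  rewrite [`|s|]gtr0_norm// [`|t|]gtr0_norm// => az bt.
  rewrite -(addrA x) [X in `|X|]addrC addKr.
  apply: le_lt_trans (ler_normD _ _) _.
  apply: le_lt_trans (lerD (norm_delta_le a i) (norm_delta_le b j)) _.
  by apply: le_lt_trans (lerD az bt) _; rewrite [d]splitr ltrD.
have inU0 a : `|a| <= `|s| -> `|x + a *: ei - x| < d.
  by move=> az; have := inU a 0 az; rewrite normr0 scale0r addr0; apply.
pose g y := f (y + t *: ej) - f y.
have dtr a : `|a| <= `|s| ->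
    is_derive (x + a *: ei) ei g
     (pderiv i f (x + a *: ei + t *: ej) - pderiv i f (x + a *: ei)).
  move=> az; apply: is_deriveB; last first.
    apply/derivableP; apply: Cinf_derivable sf _.
    exact: (dP _ (inU0 a az)).1.
  have dd : derivable f (x + a *: ei + t *: ej) ei.
    by apply: Cinf_derivable sf _; exact: (dP _ (inU a t az _)).1.
  have e1 : (fun h : R => h^-1 *: (((fun y => f (y + t *: ej)) \o
      shift (x + a *: ei)) (h *: ei) - f (x + a *: ei + t *: ej))) =
      (fun h : R => h^-1 *: ((f \o shift (x + a *: ei + t *: ej)) (h *: ei)
        - f (x + a *: ei + t *: ej))).
    by apply/funext => h /=; rewrite -!addrA.
  apply: DeriveDef; first by rewrite /derivable /= e1.
  by rewrite /derive /= e1.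
have [a az ea] := @MVT_line_sym g x ei s
  (fun a az => @ex_derive _ _ _ _ _ _ _ (dtr a az)).
have [b bt eb] := @MVT_line_sym (pderiv i f) (x + a *: ei) ej t
  (fun b bt => Cinf_derivable (Cinf_pderiv i sf) (dP _ (inU a b az bt)).1).
rewrite -[X in `|X - _|]/(g (x + s *: ei) - g x) ea.
rewrite (@derive_val _ _ _ _ _ _ _ (dtr a az)) eb.
rewrite mulrA -mulrBr normrM gtr0_norm ?mulr_gt0// ler_pM2l ?mulr_gt0//.
by rewrite distrC; exact: (dP _ (inU a b az bt)).2.
Unshelve. all: by end_near. Qed.

(** The second difference over a square is symmetric in [i] and [j], hence approximates both mixed
    derivatives. *)
Lemma pderivC U f x (i j : 'I_n) : open U -> U x -> Cinf U f ->
  pderiv i (pderiv j f) x = pderiv j (pderiv i f) x.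
Proof.
move=> oU Ux sf; apply/eqP; rewrite -subr_eq0 -normr_le0.
apply/ler_addgt0Pl => e e0; rewrite addr0.
have [d d0 dP] := pderiv_pderivC_near i j oU Ux sf (divr_gt0 e0 (ltr0n R 2)).
have [d' d'0 dP'] := pderiv_pderivC_near j i oU Ux sf (divr_gt0 e0 (ltr0n R 2)).
pose s := Num.min d d' / 2.
have m0 : 0 < Num.min d d' by rewrite lt_min d0.
have s0 : 0 < s by rewrite divr_gt0.
have sm : s < Num.min d d' by rewrite ltr_pdivrMr// ltr_pMr// ltr1n.
have [sd sd'] : 0 < s < d /\ 0 < s < d'.
  by move: sm; rewrite s0 lt_min => /andP.
have := lerD (dP s s sd sd) (dP' s s sd' sd').
rewrite -mulrDr -splitr => le_e.
rewrite -(ler_pM2l (mulr_gt0 s0 s0)); apply: le_trans le_e.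
rewrite -[s * s in leLHS]gtr0_norm ?mulr_gt0// -normrM mulrBr.
set A := f (x + s *: delta_mx 0 i + s *: delta_mx 0 j).
rewrite [x + s *: delta_mx 0 j + s *: _]addrAC -/A.
apply: le_trans (ler_normB _ _); rewrite le_eqVlt; apply/orP; left.
have alg (a b c c' p q : R) : s * s * p - s * s * q =
    (a - b - (c - c') - s * s * q) - (a - c - (b - c') - s * s * p) by ring.
by apply/eqP; congr `|_|; exact: alg.
Qed.

Lemma max_first_order U f x v : open U -> U x -> Cinf U f ->
  (forall y, U y -> f y <= f x) -> 'D_v f x = 0.
Proof.
move=> oU Ux sf mx; have [d d0 dP] := ball_line v oU Ux.
have inI (t : R) : t \in `]-d, d[ -> U (x + t *: v).
  by rewrite in_itv/= -ltr_norml => /dP.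
have I0 : 0 \in `]-d, d[ by rewrite in_itv/= oppr_lt0 d0.
have dl t : t \in `]-d, d[ -> is_derive t 1 (fun s : R => f (x + s *: v))
    ('D_v f (x + t *: v)).
  move=> /inI tU; apply: is_derive_line.
  exact: (deriveE_pderiv v oU tU (sf 1%N)).1.
have d0d : - d <= d by rewrite (@le_trans _ _ 0)// ?oppr_le0 ltW.
have mxI t : t \in `]-d, d[ -> f (x + t *: v) <= f (x + 0 *: v).
  by move=> /inI tU; rewrite scale0r addr0; exact: mx.
have /(@derive_val _ _ _ _ _ _ _) :=
  derive1_at_max d0d (fun t tI => @ex_derive _ _ _ _ _ _ _ (dl t tI)) I0 mxI.
by rewrite (@derive_val _ _ _ _ _ _ _ (dl 0 I0)) scale0r addr0.
Qed.

(** The directional derivative [g] vanishes at [x]; were its own derivative along [v] positive, [g]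
    would be positive just after [x], and the mean value theorem would make [f] exceed its
    maximum. *)
Lemma max_second_order U f x v : open U -> U x -> Cinf U f ->
  (forall y, U y -> f y <= f x) ->
  \sum_i \sum_j v 0 i * v 0 j * pderiv j (pderiv i f) x <= 0.
Proof.
move=> oU Ux sf mx; pose g y := \sum_i v 0 i * pderiv i f y.
have sg : Cinf U g.
  by apply: Cinf_sum => // i; apply: CinfM => //;
    [exact: Cinf_cst|exact: Cinf_pderiv].
have gE y : U y -> 'D_v f y = g y.
  by move=> Uy; rewrite (deriveE_pderiv v oU Uy (sf 1%N)).2.
have g0 : g x = 0 by rewrite -gE// (max_first_order v oU Ux sf mx).
have [dg dgE] := deriveE_pderiv v oU Ux (sg 1%N).
have -> : \sum_i \sum_j v 0 i * v 0 j * pderiv j (pderiv i f) x = 'D_v g x.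
  rewrite dgE exchange_big/=; apply: eq_bigr => j _.
  rewrite (pderiv_sum (U := U)) => // [|k]; last first.
    by apply: CinfM => //; [exact: Cinf_cst|exact: Cinf_pderiv].
  rewrite mulr_sumr; apply: eq_bigr => i _.
  rewrite pderivM ?pderiv_cst ?mul0r ?add0r; last 2 first.
  - by apply: derivable_cst.
  - by apply: Cinf_derivable Ux; exact: Cinf_pderiv.
  by rewrite mulrCA mulrA.
rewrite leNgt; apply/negP => Dg0.
have [d d0 dP] := ball_line v oU Ux.
have /cvgrPdist_lt/(_ _ Dg0) := dg.
rewrite -/('D_v g x) => /nbhs_ballP[e /= e0 eP].
have gpos t : 0 < t < e -> 0 < g (x + t *: v).
  move=> /andP[t0 te]; have := eP t.
  rewrite /ball/= sub0r normrN gtr0_norm// gt_eqF// => /(_ te isT).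
  rewrite g0 subr0 [t *: v + x]addrC => H.
  have : 0 < t^-1 *: g (x + t *: v).
    by move: H; rewrite ltr_norml => /andP[_]; rewrite ltrBlDr ltrDl.
  by rewrite pmulr_rgt0// invr_gt0.
pose t := Num.min d e / 2.
have m0 : 0 < Num.min d e by rewrite lt_min d0.
have t0 : 0 < t by rewrite divr_gt0.
have : t < Num.min d e by rewrite ltr_pdivrMr// ltr_pMr// ltr1n.
rewrite lt_min => /andP[td te].
have inU s : 0 <= s <= t -> U (x + s *: v).
  by move=> /andP[s0 st]; apply: dP; rewrite ger0_norm//; exact: le_lt_trans td.
have [s sI|s /andP[s0 st]] := @MVT_line f x v 0 t t0.
  exact: (deriveE_pderiv v oU (inU s sI) (sf 1%N)).1.
rewrite scale0r addr0 subr0 gE; last by apply: inU; rewrite !ltW.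
have := mx _ (inU t _); rewrite lexx ltW// => /(_ isT); rewrite -subr_le0.
move=> + E; rewrite E leNgt => /negP; apply; rewrite mulr_gt0// gpos// s0.
exact: lt_trans te.
Qed.

End SeveralVariables.

(** * Positive definite matrices *)

Section PositiveDefinite.
Variable R : rcfType.

Definition posdef n (G : 'M[R]_n) :=
  G^T = G /\ forall v : 'rV[R]_n, v != 0 -> 0 < (v *m G *m v^T) 0 0.

(** Symmetric Gaussian elimination: [L1] clears the first row and column, and the Schur complement
    [S] is again positive definite. *)
Lemma posdef_congr1 n (G : 'M[R]_n) : posdef G ->
  exists L : 'M[R]_n, L *m G *m L^T = 1%:M.
Proof.
elim: n G => [|n IH]; first by exists 0; apply/matrixP => -[].
change (forall G : 'M[R]_(1 + n), posdef G ->
  exists L : 'M[R]_(1 + n), L *m G *m L^T = 1%:M) => G [symG posG].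
pose a := ulsubmx G; pose b := ursubmx G.
pose S := drsubmx G - (a 0 0)^-1 *: (b^T *m b).
have aE : a = (a 0 0)%:M by rewrite [LHS]mx11_scalar.
have bT : dlsubmx G = b^T by rewrite /b trmx_ursub symG.
have a0 : 0 < a 0 0.
  have /posG : row_mx 1%:M 0 != 0 :> 'rV[R]_(1 + n).
    apply/eqP => /matrixP/(_ 0 (lshift n 0)); rewrite row_mxEl !mxE.
    by move/eqP; rewrite oner_eq0.
  rewrite -[G]submxK mul_row_block !mul1mx !mul0mx !addr0 tr_row_mx mul_row_col.
  by rewrite trmx1 mulmx1 trmx0 mulmx0 addr0.
pose L1 : 'M[R]_(1 + n) := block_mx 1%:M 0 (- (a 0 0)^-1 *: b^T) 1%:M.
have L1G : L1 *m G *m L1^T = block_mx a 0 0 S.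
  rewrite -{1}[G]submxK /L1 bT -/a -/b tr_block_mx !trmx1 trmx0 linearZ/= trmxK.
  rewrite !mulmx_block !mul1mx !mul0mx !mulmx1 !mulmx0 !addr0.
  have e1 : - (a 0 0)^-1 *: b^T *m a + b^T = 0.
    rewrite {2}aE mul_mx_scalar scalerA mulrN divff ?gt_eqF// scaleN1r.
    by rewrite addNr.
  have e2 : a *m (- (a 0 0)^-1 *: b) + b = 0.
    rewrite {1}aE mul_scalar_mx scalerA mulrN divff ?gt_eqF// scaleN1r.
    by rewrite addNr.
  rewrite e1 e2 mul0mx add0r; congr block_mx.
  by rewrite /S addrC -scalemxAl scaleNr.
have posS : posdef S.
  split.
    rewrite /S linearB/= linearZ/= trmx_mul trmxK; congr (_ - _).
    by rewrite trmx_drsub symG.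
  (* The elimination matrix carries a test vector for [S] to one for [G] with the same value of the
     quadratic form. *)
  move=> w w0; pose v : 'rV[R]_(1 + n) := row_mx 0 w *m L1.
  have -> : w *m S *m w^T = v *m G *m v^T.
    have -> : v *m G *m v^T =
        row_mx 0 w *m (L1 *m G *m L1^T) *m (row_mx 0 w)^T.
      by rewrite /v trmx_mul !mulmxA.
    rewrite L1G mul_row_block !(mul0mx, mulmx0, add0r) tr_row_mx mul_row_col.
    by rewrite mul0mx add0r.
  apply: posG; apply: contra_neq w0.
  rewrite /v /L1 mul_row_block mul0mx mul0mx mulmx1 !add0r.
  by rewrite -[RHS]row_mx0 => /eq_row_mx[].
have [L' L'S] := IH _ posS.
pose D : 'M[R]_(1 + n) := block_mx (Num.sqrt (a 0 0))^-1%:M 0 0 L'.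
exists (D *m L1).
have -> : D *m L1 *m G *m (D *m L1)^T = D *m (L1 *m G *m L1^T) *m D^T.
  by rewrite trmx_mul !mulmxA.
rewrite L1G /D tr_block_mx !trmx0 !mulmx_block !(mul0mx, mulmx0) !(addr0, add0r).
rewrite L'S tr_scalar_mx mul_scalar_mx mul_mx_scalar scalerA -invfM -expr2.
rewrite sqr_sqrtr ?ltW//; set c := (a 0 0)^-1; rewrite aE scale_scalar_mx.
rewrite /c mulVf ?gt_eqF//.
by rewrite !mul0mx -scalar_mx_block.
Qed.

(** The factorization of the inverse lets traces against it be rewritten as sums of squares or of
    values of a quadratic form. *)
Lemma posdef_invmx n (G : 'M[R]_n) : posdef G ->
  G \in unitmx /\ exists P : 'M[R]_n, invmx G = P *m P^T.
Proof.
move=> /posdef_congr1[L LG].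
have [LGu LTu] := mulmx1_unit LG.
have Gu : G \in unitmx by move: LGu; rewrite unitmx_mul => /andP[].
split=> //; exists L^T; rewrite trmxK.
have LT1 : L^T *m (L *m G) = 1%:M by apply: mulmx1C.
by rewrite -[LHS]mul1mx -LT1 -!mulmxA mulmxV// mulmx1.
Qed.

Lemma mxtrace_tr_sq n (T : 'M[R]_n) : 0 <= \tr (T *m T^T).
Proof.
apply: sumr_ge0 => i _; rewrite mxE; apply: sumr_ge0 => j _.
by rewrite mxE -expr2 sqr_ge0.
Qed.

(** An endomorphism with raised index need not be a symmetric matrix, but by cyclicity of the trace
    it may be replaced by the symmetric P^T S P, whose square has the squared Frobenius norm as
    trace. *)
Lemma mxtrace_sq_ge0 n (G S : 'M[R]_n) : posdef G -> S^T = S ->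
  0 <= \tr ((S *m invmx G) *m (S *m invmx G)).
Proof.
move=> /posdef_invmx[_ [P ->]] symS.
have -> : \tr (S *m (P *m P^T) *m (S *m (P *m P^T))) =
    \tr ((P^T *m S *m P) *m (P^T *m S *m P)^T).
  rewrite !trmx_mul trmxK symS mxtrace_mulC !mulmxA.
  by rewrite mxtrace_mulC !mulmxA mxtrace_mulC !mulmxA.
exact: mxtrace_tr_sq.
Qed.

Lemma mxtrace_sq_shift n (G H : 'M[R]_n) (c : R) : posdef G -> H^T = H ->
  0 <= \tr ((H *m invmx G) *m (H *m invmx G)) + 2 * c * \tr (H *m invmx G)
       + n%:R * c ^+ 2.
Proof.
move=> pG symH; have [uG _] := posdef_invmx pG.
have := @mxtrace_sq_ge0 _ G (H + c *: G) pG.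
rewrite linearD/= linearZ/= symH pG.1 => /(_ erefl).
rewrite mulmxDl -scalemxAl mulmxV//; set A := H *m invmx G.
rewrite mulmxDl !mulmxDr -scalemxAl -!scalemxAr !mul1mx !mulmx1.
rewrite !mxtraceD !mxtraceZ mxtrace1.
by congr (0 <= _); ring.
Qed.

(** The trace equals that of P^T S P, whose diagonal entries are values of the form on the rows of
    P^T. *)
Lemma mxtrace_inv_le0 n (G S : 'M[R]_n) : posdef G ->
  (forall v : 'rV[R]_n, (v *m S *m v^T) 0 0 <= 0) -> \tr (invmx G *m S) <= 0.
Proof.
move=> /posdef_invmx[_ [P ->]] nS.
rewrite -mulmxA mxtrace_mulC; apply: sumr_le0 => i _.
have := nS (row i P^T); congr (_ <= 0).
rewrite tr_row trmxK -row_mul [LHS]mxE [RHS]mxE.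
by apply: eq_bigr => k _; congr (_ * _); rewrite mxE.
Qed.

End PositiveDefinite.

(** * The Hessian in a chart *)

Lemma sum_delta (R : comNzRingType) m (i : 'I_m) (F : 'I_m -> R) :
  \sum_j (i == j)%:R * F j = F i.
Proof.
rewrite (bigD1 i)//= eqxx mul1r big1 ?addr0// => j ji.
by rewrite eq_sym (negPf ji) mul0r.
Qed.

(** Syntax-directed and blind to the content of named functions: smoothness facts about families
    such as [christoffel] have to be put in the context beforehand. *)
Ltac smooth := repeat first
  [ assumption
  | match goal with H : forall _, Cinf _ _ |- _ => apply: H end
  | match goal with H : forall _ _, Cinf _ _ |- _ => apply: H end
  | match goal with H : forall _ _ _, Cinf _ _ |- _ => apply: H end
  | apply: Cinf_cst
  | apply: Cinf_pderiv
  | apply: CinfX | apply: CinfM | apply: CinfB | apply: CinfN | apply: CinfD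
  | apply: Cinf_sum => // ? ].

Section ChartGeometry.
Variables (R : realType) (m : nat) (U : set 'rV[R]_m).
Variables (g : 'rV[R]_m -> 'M[R]_m) (f : 'rV[R]_m -> R).
Hypotheses (oU : open U) (sg : forall i j, Cinf U (fun x => g x i j)).
Hypotheses (pg : forall x, U x -> posdef (g x)) (sf : Cinf U f).
Implicit Types (i j k l h : 'I_m) (x : 'rV[R]_m).

Local Notation Gam := (christoffel g).

Definition grad h x : R := \sum_k invmx (g x) h k * pderiv k f x.

Definition hess i j x : R :=
  pderiv i (pderiv j f) x - \sum_h Gam i j h x * pderiv h f x.

(* The Hessian with its second index raised: phi_,i^h. *)
Definition hess_endo i h x : R :=
  pderiv i (grad h) x + \sum_j Gam i j h x * grad j x.

Definition grad_sq x : R := \sum_h grad h x * pderiv h f x.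

(* phi_,i^h_,h *)
Definition div_hess i x : R :=
  \sum_h (pderiv h (hess_endo i h) x
          - \sum_j Gam h i j x * hess_endo j h x
          + \sum_j Gam h j h x * hess_endo i j x).

Lemma gram_unit x : U x -> g x \in unitmx.
Proof. by move=> /pg/posdef_invmx[]. Qed.

Lemma gram_symE x i j : U x -> g x i j = g x j i.
Proof. by move=> /pg[gT _]; rewrite -{1}gT mxE. Qed.

Lemma gram_inv_sym x i j : U x -> invmx (g x) i j = invmx (g x) j i.
Proof. by move=> /pg[gT _]; rewrite -{1}gT -trmx_inv mxE. Qed.

Lemma gram_invl x i j : U x -> \sum_k invmx (g x) i k * g x k j = (i == j)%:R.
Proof.
move=> Ux; have := mulVmx (gram_unit Ux) => /matrixP/(_ i j).
by rewrite !mxE => <-.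
Qed.

Lemma gram_contract x j (T : 'I_m -> R) : U x ->
  \sum_k (\sum_l invmx (g x) k l * T l) * g x k j = T j.
Proof.
move=> Ux; rewrite -[RHS](sum_delta j T).
under eq_bigr do rewrite mulr_suml.
rewrite exchange_big/=; apply: eq_bigr => l _.
rewrite eq_sym -(gram_invl l j Ux) mulr_suml; apply: eq_bigr => k _.
by rewrite (gram_inv_sym k l Ux); ring.
Qed.

Lemma Cinf_gram_inv i j : Cinf U (fun x => invmx (g x) i j).
Proof. by apply: Cinf_invmx => //; exact: gram_unit. Qed.

Lemma Cinf_christoffel i j k : Cinf U (Gam i j k).
Proof. by have sgi := Cinf_gram_inv; rewrite /christoffel; smooth. Qed.

Lemma Cinf_grad h : Cinf U (grad h).
Proof. by have sgi := Cinf_gram_inv; rewrite /grad; smooth. Qed.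

Lemma Cinf_hess_endo i h : Cinf U (hess_endo i h).
Proof.
have sG := Cinf_christoffel; have sgr := Cinf_grad; rewrite /hess_endo.
by smooth.
Qed.

Lemma Cinf_grad_sq : Cinf U grad_sq.
Proof.
have sgr := Cinf_grad; rewrite /grad_sq.
by smooth.
Qed.

Lemma pderiv_gram_sym x i j k : U x ->
  pderiv i (fun y => g y j k) x = pderiv i (fun y => g y k j) x.
Proof. by move=> Ux; apply: pderiv_ext Ux _ => // y Uy; exact: gram_symE. Qed.

Lemma christoffel_sym x i j k : U x -> Gam i j k x = Gam j i k x.
Proof.
move=> Ux; rewrite /christoffel; congr (_ * _); apply: eq_bigr => l _.
by rewrite (pderiv_gram_sym l i j Ux); congr (_ * _); ring.
Qed.

Lemma christoffel_lower x i j k : U x ->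
  \sum_l Gam i j l x * g x l k =
  2^-1 * (pderiv i (fun y => g y j k) x + pderiv j (fun y => g y i k) x
          - pderiv k (fun y => g y i j) x).
Proof.
move=> Ux; rewrite -(gram_contract k (fun k =>
  pderiv i (fun y => g y j k) x + pderiv j (fun y => g y i k) x
  - pderiv k (fun y => g y i j) x) Ux) mulr_sumr.
by apply: eq_bigr => l _; rewrite /christoffel -mulrA.
Qed.

(** The metric is parallel: in the sum of the two lowered symbols all other derivatives of [g]
    cancel. *)
Lemma metric_compat x i j k : U x ->
  pderiv i (fun y => g y j k) x =
  \sum_l Gam i j l x * g x l k + \sum_l Gam i k l x * g x l j.
Proof.
move=> Ux; rewrite !christoffel_lower// (pderiv_gram_sym i k j Ux).
rewrite (pderiv_gram_sym k i j Ux) (pderiv_gram_sym j i k Ux).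
rewrite -(pderiv_gram_sym k i j Ux).
by field.
Qed.

Lemma grad_lower x j : U x -> \sum_h grad h x * g x h j = pderiv j f x.
Proof. exact: gram_contract. Qed.

(** Lowering an index commutes with covariant differentiation, by [metric_compat]. *)
Lemma hess_lower x i j : U x ->
  hess i j x = \sum_h hess_endo i h x * g x h j.
Proof.
move=> Ux; rewrite /hess.
have -> : pderiv i (pderiv j f) x =
    \sum_h (pderiv i (grad h) x * g x h j
            + grad h x * pderiv i (fun y => g y h j) x).
  transitivity (pderiv i (fun y => \sum_h grad h y * g y h j) x).
    by apply: pderiv_ext Ux _ => // y Uy; rewrite grad_lower.
  rewrite (pderiv_sum (U := U))// => [|h]; last first.
    by apply: CinfM => //; exact: Cinf_grad.
  apply: eq_bigr => h _; rewrite pderivM//.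
    exact: Cinf_derivable (Cinf_grad h) Ux.
  exact: Cinf_derivable (sg h j) Ux.
under eq_bigr do rewrite metric_compat// mulrDr.
under [in RHS]eq_bigr do rewrite /hess_endo mulrDl.
rewrite !big_split/= -!addrA; congr (_ + _).
have -> : \sum_h grad h x * \sum_l Gam i j l x * g x l h =
    \sum_h Gam i j h x * pderiv h f x.
  under eq_bigr do rewrite mulr_sumr.
  rewrite exchange_big/=; apply: eq_bigr => l _.
  rewrite -grad_lower// mulr_sumr; apply: eq_bigr => h _.
  by rewrite (gram_symE l h Ux); ring.
rewrite subrr addr0; under [in RHS]eq_bigr do rewrite mulr_suml.
under eq_bigr do rewrite mulr_sumr.
rewrite exchange_big/=; apply: eq_bigr => l _; apply: eq_bigr => h _; ring.
Qed.

Lemma hess_sym x i j : U x -> hess i j x = hess j i x.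
Proof.
move=> Ux; rewrite /hess (pderivC i j oU Ux sf); congr (_ - _).
by apply: eq_bigr => h _; rewrite (christoffel_sym i j h Ux).
Qed.

Lemma hess_grad x i : U x ->
  \sum_h hess i h x * grad h x = \sum_h hess_endo i h x * pderiv h f x.
Proof.
move=> Ux; under eq_bigr do rewrite hess_lower// mulr_suml.
rewrite exchange_big/=; apply: eq_bigr => h _.
rewrite -grad_lower// mulr_sumr; apply: eq_bigr => l _.
by rewrite (gram_symE h l Ux); ring.
Qed.

Lemma pderiv_grad_sq x i : U x ->
  pderiv i grad_sq x = 2 * \sum_h hess_endo i h x * pderiv h f x.
Proof.
move=> Ux; rewrite (pderiv_sum (U := U))// => [|h]; last first.
  by apply: CinfM => //; [exact: Cinf_grad|smooth].
transitivity (\sum_h (pderiv i (grad h) x * pderiv h f x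
                      + grad h x * pderiv i (pderiv h f) x)).
  apply: eq_bigr => h _; rewrite pderivM//.
    exact: Cinf_derivable (Cinf_grad h) Ux.
  by apply: Cinf_derivable Ux; smooth.
rewrite mulr2n mulrDl mul1r -{1}hess_grad// addrC -big_split/=.
have dg h : pderiv i (grad h) x =
    hess_endo i h x - \sum_l Gam i l h x * grad l x by rewrite addrK.
have dd h : pderiv i (pderiv h f) x =
    hess i h x + \sum_l Gam i h l x * pderiv l f x by rewrite subrK.
under eq_bigr do rewrite dg dd.
(* A Christoffel double sum minus itself, inserted to cancel the corrections coming from [dg] and
   [dd]. *)
rewrite -[RHS]addr0 -[X in _ + X](subrr
  (\sum_h \sum_l Gam i l h x * grad l x * pderiv h f x)).
rewrite {1}exchange_big/= -sumrB -big_split/=; apply: eq_bigr => h _.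
rewrite mulrBl mulrDr mulr_sumr -mulr_suml.
have -> : \sum_l grad h x * (Gam i h l x * pderiv l f x) =
  \sum_j Gam i h j x * grad h x * pderiv j f x.
  by apply: eq_bigr => l _; ring.
ring.
Qed.

(** Symmetry of the Hessian carries the free index from the first slot to the raised one. *)
Lemma grad_grad_sq x k : U x ->
  \sum_i invmx (g x) k i * pderiv i grad_sq x =
  2 * \sum_j hess_endo j k x * grad j x.
Proof.
move=> Ux; rewrite mulr_sumr.
transitivity (\sum_i \sum_h \sum_l
   2 * grad h x * hess_endo h l x * (invmx (g x) k i * g x i l)).
  apply: eq_bigr => i _; rewrite pderiv_grad_sq// -hess_grad// mulrCA.
  rewrite [X in 2 * X]mulr_sumr [LHS]mulr_sumr.
  apply: eq_bigr => h _; rewrite hess_sym// hess_lower// mulr_suml.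
  rewrite [X in 2 * X]mulr_sumr [LHS]mulr_sumr.
  by apply: eq_bigr => l _; rewrite (gram_symE l i Ux); ring.
rewrite exchange_big/=; apply: eq_bigr => h _.
rewrite exchange_big/=.
under eq_bigr do rewrite -mulr_sumr gram_invl// mulrC.
by rewrite sum_delta; ring.
Qed.

(** Product rule for the divergence of Hess(grad f), that is, of half the gradient of Q; it is the
    source of the |Hess|^2 term. *)
Lemma div_hess_grad x : U x ->
  \sum_k pderiv k (fun y => \sum_j hess_endo j k y * grad j y) x
  + \sum_k \sum_j Gam k j k x * (\sum_l hess_endo l j x * grad l x) =
  \sum_i div_hess i x * grad i x
  + \sum_j \sum_k hess_endo j k x * hess_endo k j x.
Proof.
move=> Ux.
have -> : \sum_k pderiv k (fun y => \sum_j hess_endo j k y * grad j y) x =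
  \sum_k \sum_j (pderiv k (hess_endo j k) x * grad j x
    + hess_endo j k x * (hess_endo k j x - \sum_l Gam k l j x * grad l x)).
  apply: eq_bigr => k _; rewrite (pderiv_sum (U := U))// => [|j]; last first.
    by apply: CinfM => //; [exact: Cinf_hess_endo|exact: Cinf_grad].
  apply: eq_bigr => j _.
  have dg : pderiv k (grad j) x =
      hess_endo k j x - \sum_l Gam k l j x * grad l x by rewrite addrK.
  rewrite -dg pderivM//.
    exact: Cinf_derivable (Cinf_hess_endo _ _) Ux.
  exact: Cinf_derivable (Cinf_grad _) Ux.
have e1 : \sum_k \sum_j (pderiv k (hess_endo j k) x * grad j x
    + hess_endo j k x * (hess_endo k j x - \sum_l Gam k l j x * grad l x)) =
  \sum_j \sum_k pderiv k (hess_endo j k) x * grad j x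
  + \sum_j \sum_k hess_endo j k x * hess_endo k j x
  - \sum_j \sum_k \sum_l Gam k j l x * hess_endo l k x * grad j x.
  rewrite exchange_big/= -big_split/=.
  rewrite [X in _ - X]exchange_big/=.
  rewrite [X in _ - X](_ : _ =
    \sum_j \sum_k \sum_l hess_endo j k x * (Gam k l j x * grad l x)).
    rewrite -sumrB; apply: eq_bigr => j _.
    rewrite -big_split/= -sumrB; apply: eq_bigr => k _.
    by rewrite mulrBr addrA; congr (_ - _); rewrite mulr_sumr.
  rewrite [RHS]exchange_big/=; apply: eq_bigr => k _.
  rewrite exchange_big/=; apply: eq_bigr => l _; apply: eq_bigr => j _; ring.
rewrite e1; have -> : \sum_i div_hess i x * grad i x =
  \sum_j \sum_k pderiv k (hess_endo j k) x * grad j x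
  - \sum_j \sum_k \sum_l Gam k j l x * hess_endo l k x * grad j x
  + \sum_j \sum_k \sum_l Gam k l k x * hess_endo j l x * grad j x.
  rewrite -sumrB -big_split/=; apply: eq_bigr => j _.
  rewrite /div_hess mulr_suml -sumrB -big_split/=; apply: eq_bigr => k _.
  by rewrite mulrDl mulrBl !mulr_suml.
have -> : \sum_k \sum_j Gam k j k x * (\sum_l hess_endo l j x * grad l x) =
  \sum_j \sum_k \sum_l Gam k l k x * hess_endo j l x * grad j x.
  rewrite [RHS]exchange_big/=; apply: eq_bigr => k _.
  rewrite [RHS]exchange_big/=; apply: eq_bigr => j _.
  by rewrite mulr_sumr; apply: eq_bigr => l _; ring.
ring.
Qed.

End ChartGeometry.

(** * The maximum principle *)

(** The pointwise algebra at the maximum: [psi] is the weight, [W] = Hess(grad, grad), [D] the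
    divergence of the Hessian paired with the gradient, [A2] = |Hess|^2 and [A1] the Laplacian. The
    two conditions preceding the one on [kappa] are the first-order condition paired with the
    gradient and the second-order condition. *)
Lemma max_scalar_contradiction (R : realFieldType) (p m : nat)
    (f psi Q W D A2 A1 kappa : R) :
  0 < f -> 0 < Q -> (0 < p)%N -> kappa <= 0 ->
  (6 + 3 / 8 * m%:R) * f ^+ 3 < psi ->
  2 * psi * W + 3 * f ^+ 2 * Q ^+ 2 = 0 ->
  12 * f ^+ 2 * W + 2 * psi * (D + A2) + 6 * f * Q ^+ 2
    + 3 * f ^+ 2 * Q * A1 <= 0 ->
  kappa * Q = (p%:R - 1) * Q ^+ 2 - f ^+ 2 * D - (p%:R - 2) * f * W ->
  (forall c, 0 <= A2 + 2 * c * A1 + m%:R * c ^+ 2) -> False.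
Proof.
move=> f0 Q0 p0 k0 psi_gt eW S0 eD A2ge.
have f30 : 0 < f ^+ 3 by rewrite exprn_gt0.
have psi0 : 0 < psi.
  by apply: lt_trans psi_gt; rewrite mulr_gt0// ltr_wpDr// mulr_ge0.
have p1 : 1 <= p%:R :> R by rewrite ler1n.
(* With this shift, [2 * psi * (A2 + 2 * c * A1)] reproduces both the |Hess|^2 and the Laplacian
   term of the second-order condition. *)
pose c := 3 * f ^+ 2 * Q / (4 * psi).
have cE : c * psi = 3 / 4 * f ^+ 2 * Q.
  by rewrite /c; field; rewrite gt_eqF.
have WE : W * psi = - (3 / 2) * f ^+ 2 * Q ^+ 2 by lra.
have H1 : 0 <= 2 * (p%:R - 1) * Q ^+ 2 * psi - 2 * kappa * Q * psi.
  have h1 : 0 <= (p%:R - 1) * (Q ^+ 2 * psi).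
    by rewrite mulr_ge0 ?subr_ge0// mulr_ge0 ?sqr_ge0// ltW.
  have h2 : kappa * (Q * psi) <= 0 by rewrite mulr_le0_ge0// mulr_ge0// ltW.
  by lra.
have key : 2 * psi * psi * f ^+ 2 * (A2 + 2 * c * A1 + m%:R * c ^+ 2)
   + psi * (2 * (p%:R - 1) * Q ^+ 2 * psi - 2 * kappa * Q * psi)
   + 3 * Q ^+ 2 * f ^+ 3 * (p%:R * psi - (6 + 3 / 8 * m%:R) * f ^+ 3) =
   f ^+ 2 * psi * (12 * f ^+ 2 * W + 2 * psi * (D + A2) + 6 * f * Q ^+ 2
    + 3 * f ^+ 2 * Q * A1).
  apply/eqP; rewrite -subr_eq0; apply/eqP.
  (* The difference of the two sides as a combination of the defects of [cE], [WE] and [eD]. *)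
  transitivity ((4 * psi * f ^+ 2 * A1
      + 2 * m%:R * f ^+ 2 * (c * psi + 3 / 4 * f ^+ 2 * Q))
        * (c * psi - 3 / 4 * f ^+ 2 * Q)
    + (2 * psi * (p%:R - 2) * f - 12 * f ^+ 4)
        * (W * psi - - (3 / 2) * f ^+ 2 * Q ^+ 2)
    + 2 * psi ^+ 2 * (kappa * Q
        - ((p%:R - 1) * Q ^+ 2 - f ^+ 2 * D - (p%:R - 2) * f * W)) * - 1).
    by clearbody c; field.
  by rewrite cE WE -eD !subrr !(mulr0, mul0r, addr0).
have : 0 < 3 * Q ^+ 2 * f ^+ 3 * (p%:R * psi - (6 + 3 / 8 * m%:R) * f ^+ 3).
  rewrite !mulr_gt0// ?exprn_gt0// subr_gt0 (lt_le_trans psi_gt)//.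
  by rewrite ler_peMl// ltW.
have : f ^+ 2 * psi * (12 * f ^+ 2 * W + 2 * psi * (D + A2) + 6 * f * Q ^+ 2
    + 3 * f ^+ 2 * Q * A1) <= 0.
  by rewrite mulr_ge0_le0// mulr_ge0 ?sqr_ge0 ?ltW.
rewrite -key leNgt => + H; rewrite ltr_wpDl//; apply: addr_ge0.
  by apply: mulr_ge0; [rewrite !mulr_ge0 ?sqr_ge0 ?ltW|exact: A2ge].
by rewrite mulr_ge0// ltW.
Qed.

Section MaximumPrinciple.
Variables (R : realType) (m p : nat) (U : set 'rV[R]_m).
Variables (g : 'rV[R]_m -> 'M[R]_m) (f : 'rV[R]_m -> R).
Hypotheses (oU : open U) (sg : forall i j, Cinf U (fun x => g x i j)).
Hypotheses (pg : forall x, U x -> posdef (g x)) (sf : Cinf U f).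
Variables (kappa C : R) (x : 'rV[R]_m).

Local Notation Q := (grad_sq g f).
Local Notation A := (hess_endo g f).
Local Notation grd := (grad g f).
Local Notation Gam := (christoffel g).

(* The mixed component of div R = 0 on a warped product over this chart whose
   fibre is p-dimensional with Einstein constant kappa; see [warped_div].     *)
Hypothesis eqn : forall i, kappa * pderiv i f x =
  (p%:R - 1) * Q x * pderiv i f x - f x ^+ 2 * div_hess g f i x
  - (p%:R - 2) * f x * \sum_h A i h x * pderiv h f x.

Lemma weighted_grad_sq_no_max : U x -> 0 < f x -> 0 < Q x -> (0 < p)%N ->
  kappa <= 0 -> (6 + 3 / 8 * m%:R) * f x ^+ 3 < C ->
  ~ (forall y, U y -> Q y * (C + f y ^+ 3) <= Q x * (C + f x ^+ 3)).
Proof.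
move=> Ux f0 Q0 p0 k0 Cgt mx.
have f30 : 0 < f x ^+ 3 by rewrite exprn_gt0.
have sQ : Cinf U Q := Cinf_grad_sq oU sg pg sf.
have sA := Cinf_hess_endo oU sg pg sf.
have sgr := Cinf_grad oU sg pg sf.
have sgi := Cinf_gram_inv oU sg pg.
pose psi y := C + f y ^+ 3; pose u y := Q y * psi y.
have spsi : Cinf U psi by rewrite /psi; smooth.
have su : Cinf U u by rewrite /u; smooth.
have du := @Cinf_derivable _ _ _ U.
have dpsi i y : U y -> pderiv i psi y = 3 * f y ^+ 2 * pderiv i f y.
  move=> Uy; have df : derivable f y (delta_mx 0 i) by exact: du Uy.
  rewrite /psi pderivD ?pderiv_cst ?add0r; last 2 first.
  - exact: derivable_cst.
  - by apply: du Uy; smooth.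
  by rewrite pderivX.
have pu i y : U y -> pderiv i u y =
    psi y * pderiv i Q y + Q y * (3 * f y ^+ 2 * pderiv i f y).
  move=> Uy; rewrite pderivM ?dpsi//; [ring|exact: du Uy|exact: du Uy].
pose V k y := \sum_j A j k y * grd j y.
have sV k : Cinf U (V k) by rewrite /V; smooth.
(* The gradient of [u] in closed form; its coordinate divergence at [x] is evaluated in two ways. *)
pose Z k y := 2 * psi y * V k y + 3 * Q y * f y ^+ 2 * grd k y.
have ZE k y : U y -> Z k y = \sum_i invmx (g y) k i * pderiv i u y.
  move=> Uy; under eq_bigr do rewrite pu// mulrDr.
  rewrite big_split/= /Z -mulrA -mulrCA -/(V k y).
  rewrite -(grad_grad_sq oU sg pg sf k Uy) mulr_sumr; congr (_ + _).
    by apply: eq_bigr => i _; rewrite mulrCA.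
  by rewrite /grad mulr_sumr; apply: eq_bigr => i _; ring.
have u0 i : pderiv i u x = 0 := max_first_order (delta_mx 0 i) oU Ux su mx.
have Z0 k : Z k x = 0 by rewrite ZE// big1// => i _; rewrite u0 mulr0.
(* As [u] is critical at [x], derivatives of the inverse metric drop out, leaving the trace of
   ordinary second derivatives. *)
have dZ_le0 : \sum_k pderiv k (Z k) x <= 0.
  pose H := \matrix_(i, k) pderiv k (pderiv i u) x.
  have -> : \sum_k pderiv k (Z k) x = \tr (invmx (g x) *m H).
    apply: eq_bigr => k _; rewrite (pderiv_ext k oU Ux (ZE k)).
    rewrite (pderiv_sum (U := U))// => [|i]; last by smooth.
    rewrite mxE; apply: eq_bigr => i _.
    rewrite pderivM; first by rewrite u0 mulr0 add0r mxE.
    - exact: du (sgi k i) Ux.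
    - by apply: du Ux; smooth.
  apply: mxtrace_inv_le0 (pg Ux) _ => v.
  have := max_second_order v oU Ux su mx; rewrite exchange_big/=.
  congr (_ <= 0); rewrite mxE; apply: eq_bigr => j _.
  rewrite mxE mulr_suml; apply: eq_bigr => i _; rewrite !mxE; ring.
pose W := \sum_k V k x * pderiv k f x.
have WE : \sum_i (\sum_h A i h x * pderiv h f x) * grd i x = W.
  rewrite /W /V; under eq_bigr do rewrite mulr_suml.
  rewrite exchange_big/=; apply: eq_bigr => h _; rewrite mulr_suml.
  by apply: eq_bigr => i _; ring.
have dQgrad : \sum_k pderiv k Q x * grd k x = 2 * W.
  rewrite -WE mulr_sumr; apply: eq_bigr => i _.
  by rewrite (pderiv_grad_sq oU sg pg sf i Ux) mulrA.
have ZW : 2 * psi x * W + 3 * f x ^+ 2 * Q x ^+ 2 = 0.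
  transitivity (\sum_k Z k x * pderiv k f x); last first.
    by rewrite big1// => k _; rewrite Z0 mul0r.
  transitivity (\sum_k (2 * psi x * (V k x * pderiv k f x)
    + 3 * Q x * f x ^+ 2 * (grd k x * pderiv k f x))).
    by rewrite big_split/= -!mulr_sumr -/W -/(grad_sq g f x); ring.
  by apply: eq_bigr => k _; rewrite /Z; ring.
pose D := \sum_i div_hess g f i x * grd i x.
pose A2 := \sum_j \sum_k A j k x * A k j x.
pose A1 := \sum_k A k k x.
have SE : \sum_k pderiv k (Z k) x = 12 * f x ^+ 2 * W + 2 * psi x * (D + A2)
    + 6 * f x * Q x ^+ 2 + 3 * f x ^+ 2 * Q x * A1.
  have dZ k : pderiv k (Z k) x = 6 * f x ^+ 2 * (V k x * pderiv k f x)
      + 2 * psi x * pderiv k (V k) x + 3 * f x ^+ 2 * (pderiv k Q x * grd k x)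
      + 6 * f x * Q x * (grd k x * pderiv k f x)
      + 3 * Q x * f x ^+ 2 * pderiv k (grd k) x.
    rewrite pderivD; last 2 first.
    - by apply: du Ux; smooth.
    - by apply: du Ux; smooth.
    rewrite pderivM; last 2 first.
    - by apply: du Ux; smooth.
    - exact: du (sV k) Ux.
    rewrite [X in _ + X]pderivM; last 2 first.
    - by apply: du Ux; smooth.
    - exact: du (sgr k) Ux.
    rewrite pderivM; last 2 first.
    - exact: derivable_cst.
    - exact: du spsi Ux.
    rewrite pderiv_cst dpsi// (_ : pderiv k (fun y => 3 * Q y * f y ^+ 2) x =
      3 * pderiv k Q x * f x ^+ 2 + 3 * Q x * (2 * f x * pderiv k f x)).
      ring.
    rewrite pderivM; last 2 first.
    - by apply: du Ux; smooth.
    - by apply: du Ux; smooth.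
    rewrite pderivX; last exact: du sf Ux.
    rewrite pderivM; last 2 first.
    - exact: derivable_cst.
    - exact: du sQ Ux.
    by rewrite pderiv_cst mul0r add0r expr1.
  have dg k : pderiv k (grd k) x =
    A k k x - \sum_j Gam k j k x * grd j x by rewrite addrK.
  have dV : \sum_k pderiv k (V k) x =
      D + A2 - \sum_k \sum_j Gam k j k x * V j x.
    by rewrite /D /A2 -(div_hess_grad oU sg pg sf Ux) addrK.
  (* The Christoffel terms separating the coordinate divergence from the covariant one are
     contracted with [Z], which vanishes at [x]. *)
  have GZ : 2 * psi x * (\sum_k \sum_j Gam k j k x * V j x)
      + 3 * Q x * f x ^+ 2 * (\sum_k \sum_j Gam k j k x * grd j x) = 0.
    rewrite [X in X + _]mulr_sumr [X in _ + X]mulr_sumr -big_split.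
    rewrite big1//= => k _.
    rewrite [X in X + _]mulr_sumr [X in _ + X]mulr_sumr -big_split.
    rewrite big1//= => j _.
    transitivity (Gam k j k x * Z j x); first by rewrite /Z; ring.
    by rewrite Z0 mulr0.
  under eq_bigr do rewrite dZ dg.
  rewrite !big_split/= -!mulr_sumr dV sumrB dQgrad -/W -/(grad_sq g f x) -/A1.
  rewrite -[RHS]subr0 -[X in _ = _ - X]GZ; ring.
rewrite SE in dZ_le0.
have eD : kappa * Q x = (p%:R - 1) * Q x ^+ 2 - f x ^+ 2 * D
    - (p%:R - 2) * f x * W.
  transitivity (\sum_i kappa * pderiv i f x * grd i x).
    by rewrite mulr_sumr; apply: eq_bigr => i _; ring.
  transitivity (\sum_i ((p%:R - 1) * Q x * (grd i x * pderiv i f x)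
    - f x ^+ 2 * (div_hess g f i x * grd i x)
    - (p%:R - 2) * f x * ((\sum_h A i h x * pderiv h f x) * grd i x))).
    by apply: eq_bigr => i _; rewrite eqn; ring.
  by rewrite !sumrB -!mulr_sumr WE -/D -/(grad_sq g f x); ring.
have A2ge c : 0 <= A2 + 2 * c * A1 + m%:R * c ^+ 2.
  pose H := \matrix_(i, j) hess g f i j x.
  have HE : \matrix_(i, j) A i j x = H *m invmx (g x).
    have gu := gram_unit pg Ux; apply: (canRL (mulmxK gu)).
    apply/matrixP => i j; rewrite !mxE (hess_lower oU sg pg sf i j Ux).
    by apply: eq_bigr => k _; rewrite !mxE.
  have Hs : H^T = H.
    by apply/matrixP => i j; rewrite !mxE (hess_sym oU pg sf j i Ux).
  have := mxtrace_sq_shift c (pg Ux) Hs; rewrite -HE.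
  congr (0 <= _ + 2 * c * _ + _).
    apply: eq_bigr => i _; rewrite mxE; apply: eq_bigr => j _.
    by rewrite !mxE.
  by apply: eq_bigr => i _; rewrite mxE.
apply: max_scalar_contradiction f0 Q0 p0 k0 _ ZW dZ_le0 eD A2ge.
by rewrite /psi ltr_wpDr// ltW.
Qed.

End MaximumPrinciple.

(** * Curvature of a warped product *)

Section Slices.
Variables (R : realType) (m p : nat).
Implicit Types (x : 'rV[R]_m) (y : 'rV[R]_p) (F : 'rV[R]_(m + p) -> R).

Lemma delta_lshift i :
  delta_mx 0 (lshift p i) = row_mx (delta_mx 0 i) 0 :> 'rV[R]_(m + p).
Proof.
apply/rowP => j; rewrite !mxE; case: (split_ordP j) => k ->.
  by rewrite (inj_eq (@lshift_inj _ _)) mxE.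
by rewrite eq_rlshift andbF mxE.
Qed.

Lemma delta_rshift a :
  delta_mx 0 (rshift m a) = row_mx 0 (delta_mx 0 a) :> 'rV[R]_(m + p).
Proof.
apply/rowP => j; rewrite !mxE; case: (split_ordP j) => k ->.
  by rewrite eq_lrshift andbF mxE.
by rewrite (inj_eq (@rshift_inj _ _)) mxE.
Qed.

Lemma pderiv_lshift F i x y :
  pderiv (lshift p i) F (row_mx x y) = pderiv i (fun x' => F (row_mx x' y)) x.
Proof.
rewrite /pderiv /derive; set q1 := fun h => _; set q2 := fun h => _.
suff -> : q1 = q2 by [].
apply/funext => h; rewrite /q1 /q2 /=.
by rewrite delta_lshift scale_row_mx add_row_mx scaler0 add0r.
Qed.

Lemma pderiv_rshift F a x y :
  pderiv (rshift m a) F (row_mx x y) = pderiv a (fun y' => F (row_mx x y')) y.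
Proof.
rewrite /pderiv /derive; set q1 := fun h => _; set q2 := fun h => _.
suff -> : q1 = q2 by [].
apply/funext => h; rewrite /q1 /q2 /=.
by rewrite delta_rshift scale_row_mx add_row_mx scaler0 add0r.
Qed.

(** Only values along the slice through [y] matter, so a component known at points of the product
    chart can be differentiated one factor at a time. *)
Lemma pderiv_lshift_ext U F f i x y : open U -> U x ->
  (forall x', U x' -> F (row_mx x' y) = f x') ->
  pderiv (lshift p i) F (row_mx x y) = pderiv i f x.
Proof. by move=> oU Ux Ff; rewrite pderiv_lshift; exact: pderiv_ext Ux Ff. Qed.

Lemma pderiv_rshift_ext T F f a x y : open T -> T y ->
  (forall y', T y' -> F (row_mx x y') = f y') ->
  pderiv (rshift m a) F (row_mx x y) = pderiv a f y.
Proof. by move=> oT Ty Ff; rewrite pderiv_rshift; exact: pderiv_ext Ty Ff. Qed.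

End Slices.

Lemma riemann_antisym (R : realType) n (g : 'rV[R]_n -> 'M[R]_n) i j l k x :
  riemann g i j l k x = - riemann g j i l k x.
Proof.
rewrite /riemann opprD opprB; congr (_ + _).
by rewrite -sumrN; apply: eq_bigr => q _; rewrite opprB.
Qed.

Section WarpedProduct.
Variables (R : realType) (m p : nat) (U : set 'rV[R]_m) (T : set 'rV[R]_p).
Variables (g : 'rV[R]_m -> 'M[R]_m) (f : 'rV[R]_m -> R).
Variable e : 'rV[R]_p -> 'M[R]_p.
Hypotheses (oU : open U) (sg : forall i j, Cinf U (fun x => g x i j)).
Hypotheses (pg : forall x, U x -> posdef (g x)) (sf : Cinf U f).
Hypothesis f_gt0 : forall x, U x -> 0 < f x.
Hypotheses (oT : open T) (se : forall a b, Cinf T (fun y => e y a b)).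
Hypothesis pe : forall y, T y -> posdef (e y).
Implicit Types (i j k h : 'I_m) (a b c d : 'I_p).
Implicit Types (x : 'rV[R]_m) (y : 'rV[R]_p).

(** With [f] the local form of [phi], this unfolds to the Gram matrix of [warped_product] in a
    product chart. *)
Definition warped_gram (u : 'rV[R]_(m + p)) : 'M[R]_(m + p) :=
  block_mx (g (lsubmx u)) 0 0 (f (lsubmx u) ^+ 2 *: e (rsubmx u)).

Local Notation G := warped_gram.
Local Notation "[ 'l' i ]" := (lshift p i) (format "[ 'l'  i ]").
Local Notation "[ 'r' a ]" := (rshift m a) (format "[ 'r'  a ]").
Local Notation Q := (grad_sq g f).
Local Notation A := (hess_endo g f).

(** Bundled as a multirule: one [rewrite] selects the block from the shape of the indices. *)
Lemma warped_gramE x y :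
  ((forall i j, G (row_mx x y) [l i] [l j] = g x i j)
  * (forall i b, G (row_mx x y) [l i] [r b] = 0)
  * (forall a j, G (row_mx x y) [r a] [l j] = 0)
  * (forall a b, G (row_mx x y) [r a] [r b] = (f x ^+ 2 * e y a b)%R))%type.
Proof.
by do ![split] => *; rewrite /G row_mxKl row_mxKr
  ?block_mxEul ?block_mxEur ?block_mxEdl ?block_mxEdr ?mxE.
Qed.

Lemma warped_gram_inv x y : U x -> T y -> invmx (G (row_mx x y)) =
  block_mx (invmx (g x)) 0 0 ((f x ^+ 2)^-1 *: invmx (e y)).
Proof.
move=> Ux Ty; rewrite /G row_mxKl row_mxKr.
have f0 : f x ^+ 2 \is a GRing.unit by rewrite unitfE expf_neq0// gt_eqF// f_gt0.
have ug := gram_unit pg Ux; have ue := gram_unit pe Ty.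
have ufe : f x ^+ 2 *: e y \in unitmx by rewrite unitmxZ.
by rewrite invmx_block_diag ?block_diag_mx_unit ?ug// invmxZ.
Qed.

Lemma warped_gram_invE x y : U x -> T y ->
  ((forall i j, invmx (G (row_mx x y)) [l i] [l j] = invmx (g x) i j)
  * (forall i b, invmx (G (row_mx x y)) [l i] [r b] = 0)
  * (forall a j, invmx (G (row_mx x y)) [r a] [l j] = 0)
  * (forall a b, invmx (G (row_mx x y)) [r a] [r b] =
       ((f x ^+ 2)^-1 * invmx (e y) a b)%R))%type.
Proof.
by move=> Ux Ty; rewrite warped_gram_inv//; do ![split] => *;
  rewrite ?block_mxEul ?block_mxEur ?block_mxEdl ?block_mxEdr ?mxE.
Qed.

Lemma pderiv_warped_gram x y : U x -> T y ->
  ((forall i j k, pderiv [l i] (fun u => G u [l j] [l k]) (row_mx x y)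
      = pderiv i (fun x => g x j k) x)
  * (forall i a b, pderiv [l i] (fun u => G u [r a] [r b]) (row_mx x y)
      = (2 * f x * pderiv i f x * e y a b)%R)
  * (forall c j k, pderiv [r c] (fun u => G u [l j] [l k]) (row_mx x y) = 0)
  * (forall c a b, pderiv [r c] (fun u => G u [r a] [r b]) (row_mx x y)
      = (f x ^+ 2 * pderiv c (fun y => e y a b) y)%R)
  * (forall q j b, pderiv q (fun u => G u [l j] [r b]) (row_mx x y) = 0)
  * (forall q a k, pderiv q (fun u => G u [r a] [l k]) (row_mx x y) = 0))%type.
Proof.
move=> Ux Ty; have df i : derivable f x (delta_mx 0 i).
  exact: Cinf_derivable sf Ux.
have G0 q1 q2 : (forall x y, G (row_mx x y) q1 q2 = 0) ->
    forall q, pderiv q (fun u => G u q1 q2) (row_mx x y) = 0.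
  move=> G0 q; rewrite (_ : (fun u => _) = fun=> 0) ?pderiv_cst//.
  by apply/funext => u; rewrite -[u]hsubmxK G0.
split; [split; [split; [split; [split|]|]|]|].
- move=> i j k; apply: (pderiv_lshift_ext _ oU Ux) => x' _.
  by rewrite warped_gramE.
- move=> i a b.
  rewrite (pderiv_lshift_ext (f := fun x' => f x' ^+ 2 * e y a b) _ oU Ux).
    rewrite pderivM; last 2 first.
    - by apply: Cinf_derivable Ux; smooth.
    - exact: derivable_cst.
    by rewrite pderivX// pderiv_cst mulr0 addr0 expr1.
  by move=> x' _; rewrite warped_gramE.
- move=> c j k; rewrite (pderiv_rshift_ext (f := fun=> g x j k) _ oT Ty).
    exact: pderiv_cst.
  by move=> y' _; rewrite warped_gramE.
- move=> c a b.
  rewrite (pderiv_rshift_ext (f := fun y' => f x ^+ 2 * e y' a b) _ oT Ty).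
    rewrite pderivM; last 2 first.
    - exact: derivable_cst.
    - exact: Cinf_derivable (se a b) Ty.
    by rewrite pderiv_cst mul0r add0r.
  by move=> y' _; rewrite warped_gramE.
- by move=> q j b; apply: G0 => *; rewrite warped_gramE.
- by move=> q a k; apply: G0 => *; rewrite warped_gramE.
Qed.

Lemma warped_christoffel x y : U x -> T y ->
  ((forall i j k,
      christoffel G [l i] [l j] [l k] (row_mx x y) = christoffel g i j k x)
  * (forall i j c, christoffel G [l i] [l j] [r c] (row_mx x y) = 0)
  * (forall i b k, christoffel G [l i] [r b] [l k] (row_mx x y) = 0)
  * (forall a j k, christoffel G [r a] [l j] [l k] (row_mx x y) = 0)
  * (forall i b c, christoffel G [l i] [r b] [r c] (row_mx x y) =
      ((b == c)%:R * (pderiv i f x / f x))%R)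
  * (forall a j c, christoffel G [r a] [l j] [r c] (row_mx x y) =
      ((a == c)%:R * (pderiv j f x / f x))%R)
  * (forall a b k, christoffel G [r a] [r b] [l k] (row_mx x y) =
      (- (f x * grad g f k x) * e y a b)%R)
  * (forall a b c,
      christoffel G [r a] [r b] [r c] (row_mx x y) = christoffel e a b c y))%type.
Proof.
move=> Ux Ty; have f0 : f x != 0 by rewrite gt_eqF ?f_gt0.
have iE := warped_gram_invE Ux Ty; have dE := pderiv_warped_gram Ux Ty.
have ei a b : \sum_d invmx (e y) a d * e y d b = (b == a)%:R.
  by rewrite (gram_invl pe)// eq_sym.
have eS a b : e y a b = e y b a := gram_symE pe a b Ty.
do 7?[split]; [move=> i j k|move=> i j c|move=> i b k|move=> a j k
  |move=> i b c|move=> a j c|move=> a b k|move=> a b c];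
  rewrite /christoffel big_split_ord/=.
- rewrite [X in _ + X]big1 ?addr0; last by move=> *; rewrite iE mul0r.
  by congr (_ * _); apply: eq_bigr => l _; rewrite iE !dE.
- by rewrite !big1 ?addr0 ?mulr0// => *; rewrite iE ?mul0r// !dE subr0 addr0 mulr0.
- by rewrite !big1 ?addr0 ?mulr0// => *; rewrite iE ?mul0r// !dE subr0 addr0 mulr0.
- by rewrite !big1 ?addr0 ?mulr0// => *; rewrite iE ?mul0r// !dE subr0 addr0 mulr0.
- rewrite [X in X + _]big1 ?add0r; last by move=> *; rewrite iE mul0r.
  rewrite -ei mulr_suml mulr_sumr; apply: eq_bigr => d _.
  by rewrite iE !dE eS; field.
- rewrite [X in X + _]big1 ?add0r; last by move=> *; rewrite iE mul0r.
  rewrite -ei mulr_suml mulr_sumr; apply: eq_bigr => d _.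
  by rewrite iE !dE eS; field.
- rewrite [X in _ + X]big1 ?addr0; last by move=> *; rewrite iE mul0r.
  transitivity (\sum_l - (f x * (invmx (g x) k l * pderiv l f x)) * e y a b);
    last by rewrite /grad mulr_sumr -sumrN mulr_suml.
  rewrite mulr_sumr; apply: eq_bigr => l _.
  by rewrite iE !dE; field.
- rewrite [X in X + _]big1 ?add0r; last by move=> *; rewrite iE mul0r.
  by congr (_ * _); apply: eq_bigr => d _; rewrite iE !dE; field.
Qed.

(** In these names [f] marks a base index and [b] a fibre index, in the order of the arguments of
    [riemann]. Here the derivative of the factor [f] in the symbol - f grad^h e_ab cancels against
    the sum over fibre indices. *)
Lemma warped_riemann_fbbf x y i a b h : U x -> T y ->
  riemann G [l i] [r a] [r b] [l h] (row_mx x y) = f x * A i h x * e y a b.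
Proof.
move=> Ux Ty; have f0 : f x != 0 by rewrite gt_eqF ?f_gt0.
rewrite /riemann (pderiv_rshift_ext (f := fun=> 0) _ oT Ty); last first.
  by move=> y' Ty'; rewrite (warped_christoffel Ux Ty').
rewrite pderiv_cst.
rewrite (pderiv_lshift_ext
  (f := fun x' => - (f x' * grad g f h x') * e y a b) _ oU Ux); last first.
  by move=> x' Ux'; rewrite (warped_christoffel Ux' Ty).
have sgr := Cinf_grad oU sg pg sf.
have du := @Cinf_derivable _ _ _ U.
rewrite pderivM; last 2 first.
- by apply: du Ux; smooth.
- exact: derivable_cst.
rewrite pderivN; last by apply: du Ux; smooth.
rewrite pderivM; last 2 first.
- exact: du sf Ux.
- exact: du (sgr h) Ux.
rewrite pderiv_cst big_split_ord/=.
have cE := warped_christoffel Ux Ty.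
rewrite (_ : \sum_(j < m) _ =
    f x * e y a b * \sum_j christoffel g i j h x * grad g f j x); last first.
  by rewrite mulr_sumr; apply: eq_bigr => j _; rewrite !cE; ring.
rewrite (_ : \sum_(c < p) _ = - grad g f h x * pderiv i f x * e y a b); last first.
  rewrite -[RHS](sum_delta b (fun c => - grad g f h x * pderiv i f x * e y a c)).
  by apply: eq_bigr => c _; rewrite !cE; field.
by rewrite /hess_endo; ring.
Qed.

Lemma warped_riemann_fbbb x y i a b c : U x -> T y ->
  riemann G [l i] [r a] [r b] [r c] (row_mx x y) = 0.
Proof.
move=> Ux Ty; have cE := warped_christoffel Ux Ty.
rewrite /riemann (pderiv_rshift_ext
  (f := fun=> (b == c)%:R * (pderiv i f x / f x)) _ oT Ty); last first.
  by move=> y' Ty'; rewrite (warped_christoffel Ux Ty').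
rewrite (pderiv_lshift_ext (f := fun=> christoffel e a b c y) _ oU Ux); last first.
  by move=> x' Ux'; rewrite (warped_christoffel Ux' Ty).
rewrite !pderiv_cst subrr add0r big_split_ord/= big1 ?add0r; last first.
  by move=> j _; rewrite !cE; ring.
transitivity (\sum_d (b == d)%:R * (christoffel e a d c y * (pderiv i f x / f x))
    - \sum_d (c == d)%:R * (christoffel e a b d y * (pderiv i f x / f x))).
  rewrite -sumrB; apply: eq_bigr => d _; rewrite !cE (eq_sym d c); ring.
by rewrite !sum_delta subrr.
Qed.

(** Gauss equation for the umbilic fibres: the Q term comes from intermediate base indices in the
    quadratic part. *)
Lemma warped_riemann_bbbb x y a b c d : U x -> T y ->
  riemann G [r d] [r a] [r b] [r c] (row_mx x y) =
  riemann e d a b c y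
  - Q x * ((a == c)%:R * e y d b - (d == c)%:R * e y a b).
Proof.
move=> Ux Ty; have f0 : f x != 0 by rewrite gt_eqF ?f_gt0.
have cE := warped_christoffel Ux Ty.
have dE a' b' d' : pderiv [r d'] (christoffel G [r a'] [r b'] [r c])
    (row_mx x y) = pderiv d' (christoffel e a' b' c) y.
  apply: (pderiv_rshift_ext _ oT Ty) => y' Ty'.
  by rewrite (warped_christoffel Ux Ty').
rewrite /riemann !dE big_split_ord/= addrCA addrC; congr (_ + _).
  by congr (_ + _); apply: eq_bigr => q _; rewrite !cE.
rewrite /grad_sq mulr_suml -sumrN; apply: eq_bigr => j _.
by rewrite !cE; field.
Qed.

(** The one-form d log f is closed. *)
Lemma warped_riemann_ffbb x y i j b c : U x -> T y ->
  riemann G [l i] [l j] [r b] [r c] (row_mx x y) = 0.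
Proof.
move=> Ux Ty; have f0 : f x != 0 by rewrite gt_eqF ?f_gt0.
have cE := warped_christoffel Ux Ty.
have dE i' j' : pderiv [l i'] (christoffel G [l j'] [r b] [r c])
    (row_mx x y) = (b == c)%:R * (pderiv i' (pderiv j' f) x / f x
      - pderiv i' f x * pderiv j' f x / f x ^+ 2).
  rewrite (pderiv_lshift_ext
    (f := fun x' => (b == c)%:R * (pderiv j' f x' * (f x')^-1)) _ oU Ux);
    last first.
    by move=> x' Ux'; rewrite (warped_christoffel Ux' Ty).
  have df k : derivable f x (delta_mx 0 k) := Cinf_derivable sf Ux.
  have ddf k l : derivable (pderiv k f) x (delta_mx 0 l) :=
    Cinf_derivable (Cinf_pderiv k sf) Ux.
  have dV k : derivable (fun x' => (f x')^-1) x (delta_mx 0 k).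
    exact: derivableV.
  rewrite pderivM; last 2 first.
  - exact: derivable_cst.
  - exact: derivableM.
  by rewrite pderiv_cst pderivM// pderivV//; field.
rewrite /riemann !dE (pderivC i j oU Ux sf) big_split_ord/= !big1 ?addr0.
- ring.
- move=> d _; rewrite !cE; ring.
- move=> k _; rewrite !cE; ring.
Qed.

Lemma warped_riemann_fbfb x y i j a c : U x -> T y ->
  riemann G [l i] [r a] [l j] [r c] (row_mx x y) =
  - ((a == c)%:R * (hess g f i j x / f x)).
Proof.
move=> Ux Ty; have f0 : f x != 0 by rewrite gt_eqF ?f_gt0.
have cE := warped_christoffel Ux Ty.
rewrite /riemann (pderiv_rshift_ext (f := fun=> 0) _ oT Ty); last first.
  by move=> y' Ty'; rewrite (warped_christoffel Ux Ty').
rewrite pderiv_cst (pderiv_lshift_ext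
    (f := fun x' => (a == c)%:R * (pderiv j f x' * (f x')^-1)) _ oU Ux);
    last first.
  by move=> x' Ux'; rewrite (warped_christoffel Ux' Ty).
have df k : derivable f x (delta_mx 0 k) := Cinf_derivable sf Ux.
have ddf k l : derivable (pderiv k f) x (delta_mx 0 l) :=
  Cinf_derivable (Cinf_pderiv k sf) Ux.
have dV k : derivable (fun x' => (f x')^-1) x (delta_mx 0 k).
  exact: derivableV.
rewrite pderivM; last 2 first.
- exact: derivable_cst.
- exact: derivableM.
rewrite pderiv_cst pderivM// pderivV// big_split_ord/=.
rewrite (_ : \sum_(k < m) _ = (a == c)%:R / f x *
    \sum_k christoffel g i j k x * pderiv k f x); last first.
  by rewrite mulr_sumr; apply: eq_bigr => k _; rewrite !cE; field.
rewrite (_ : \sum_(d < p) _ =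
    - ((a == c)%:R * (pderiv i f x / f x * (pderiv j f x / f x)))); last first.
  rewrite -[RHS](sum_delta a (fun d =>
    - ((d == c)%:R * (pderiv i f x / f x * (pderiv j f x / f x))))).
  by apply: eq_bigr => d _; rewrite !cE; field.
by rewrite /hess; field.
Qed.

Lemma warped_riemann_ffbf x y i h a k : U x -> T y ->
  riemann G [l i] [l h] [r a] [l k] (row_mx x y) = 0.
Proof.
move=> Ux Ty; have cE := warped_christoffel Ux Ty.
have dE i' j' : pderiv [l i'] (christoffel G [l j'] [r a] [l k])
    (row_mx x y) = 0.
  rewrite (pderiv_lshift_ext (f := fun=> 0) _ oU Ux) ?pderiv_cst// => x' Ux'.
  by rewrite (warped_christoffel Ux' Ty).
rewrite /riemann !dE big_split_ord/= !big1 ?addr0 ?subrr//.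
- move=> d _; rewrite !cE; ring.
- move=> j _; rewrite !cE; ring.
Qed.

(** Here [h] is not summed: the sum over [h] will assemble [div_hess]. One derivative of the factor
    [f] against two connection terms in the fibre slots leaves the coefficient -1 of the last
    term. *)
Lemma warped_cov_base x y i a b h : U x -> T y ->
  cov_riemann G [l i] [r a] [r b] [l h] [l h] (row_mx x y) =
  e y a b * (f x * (pderiv h (A i h) x
      - \sum_j christoffel g h i j x * A j h x
      + \sum_j christoffel g h j h x * A i j x)
    - pderiv h f x * A i h x).
Proof.
move=> Ux Ty; have f0 : f x != 0 by rewrite gt_eqF ?f_gt0.
rewrite /cov_riemann !big_split_ord/=.
rewrite (pderiv_lshift_ext (f := fun x' => f x' * A i h x' * e y a b) _ oU Ux);
  last by move=> x' Ux'; apply: (warped_riemann_fbbf).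
have sA := Cinf_hess_endo oU sg pg sf.
have du := @Cinf_derivable _ _ _ U.
rewrite pderivM; last 2 first.
- by apply: du Ux; smooth.
- exact: derivable_cst.
rewrite pderivM; last 2 first.
- exact: du sf Ux.
- exact: du (sA i h) Ux.
have bf j c d k := warped_riemann_fbbf j c d k Ux Ty.
rewrite pderiv_cst.
rewrite (_ : \sum_(j < m) christoffel G [l h] [l i] [l j] _ * _ =
    f x * e y a b * \sum_j christoffel g h i j x * A j h x); last first.
  rewrite mulr_sumr; apply: eq_bigr => j _.
  by rewrite (warped_christoffel Ux Ty) bf; ring.
rewrite (_ : \sum_(d < p) christoffel G [l h] [l i] [r d] _ * _ = 0); last first.
  by rewrite big1// => d _; rewrite (warped_christoffel Ux Ty) mul0r.
rewrite (_ : \sum_(j < m) christoffel G [l h] [r a] [l j] _ * _ = 0); last first.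
  by rewrite big1// => j _; rewrite (warped_christoffel Ux Ty) mul0r.
rewrite (_ : \sum_(d < p) christoffel G [l h] [r a] [r d] _ * _ =
    pderiv h f x * A i h x * e y a b); last first.
  rewrite -[RHS](sum_delta a (fun d => pderiv h f x * A i h x * e y d b)).
  by apply: eq_bigr => d _; rewrite (warped_christoffel Ux Ty) bf; field.
rewrite (_ : \sum_(j < m) christoffel G [l h] [r b] [l j] _ * _ = 0); last first.
  by rewrite big1// => j _; rewrite (warped_christoffel Ux Ty) mul0r.
rewrite (_ : \sum_(d < p) christoffel G [l h] [r b] [r d] _ * _ =
    pderiv h f x * A i h x * e y a b); last first.
  rewrite -[RHS](sum_delta b (fun d => pderiv h f x * A i h x * e y a d)).
  by apply: eq_bigr => d _; rewrite (warped_christoffel Ux Ty) bf; field.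
rewrite (_ : \sum_(j < m) christoffel G [l h] [l j] [l h] _ * _ =
    f x * e y a b * \sum_j christoffel g h j h x * A i j x); last first.
  rewrite mulr_sumr; apply: eq_bigr => j _.
  by rewrite (warped_christoffel Ux Ty) bf; ring.
rewrite (_ : \sum_(d < p) christoffel G [l h] [r d] [l h] _ * _ = 0); last first.
  by rewrite big1// => d _; rewrite (warped_christoffel Ux Ty) mul0r.
ring.
Qed.

(** The differentiated component vanishes identically, so everything comes from connection terms
    that exchange a fibre index for a base index or conversely. *)
Lemma warped_cov_fibre x y i a b c : U x -> T y ->
  cov_riemann G [l i] [r a] [r b] [r c] [r c] (row_mx x y) =
  - (pderiv i f x / f x * (riemann e c a b c y
       - Q x * ((a == c)%:R * e y c b - e y a b)))
  - (a == c)%:R * (e y c b * \sum_h A i h x * pderiv h f x)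
  + e y a b * \sum_h A i h x * pderiv h f x.
Proof.
move=> Ux Ty; have f0 : f x != 0 by rewrite gt_eqF ?f_gt0.
rewrite /cov_riemann !big_split_ord/=.
have bf j c' d k := warped_riemann_fbbf j c' d k Ux Ty.
have fb j a' b' c' :=
  warped_riemann_fbbb j a' b' c' Ux Ty.
rewrite (pderiv_rshift_ext (f := fun=> 0) _ oT Ty) ?pderiv_cst; last first.
  by move=> y' Ty'; apply: (warped_riemann_fbbb).
rewrite (_ : \sum_(j < m) christoffel G [r c] [l i] [l j] _ * _ = 0); last first.
  by rewrite big1// => j _; rewrite (warped_christoffel Ux Ty) mul0r.
rewrite (_ : \sum_(d < p) christoffel G [r c] [l i] [r d] _ * _ =
    pderiv i f x / f x * (riemann e c a b c y
       - Q x * ((a == c)%:R * e y c b - e y a b))); last first.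
  transitivity (\sum_d (c == d)%:R * (pderiv i f x / f x * (riemann e d a b c y
       - Q x * ((a == c)%:R * e y d b - (d == c)%:R * e y a b)))).
    apply: eq_bigr => d _; rewrite (warped_christoffel Ux Ty).
    rewrite (warped_riemann_bbbb _ _ _ _ Ux Ty).
    by rewrite -mulrA.
  by rewrite sum_delta eqxx mul1r.
rewrite (_ : \sum_(j < m) christoffel G [r c] [r a] [l j] _ * _ = 0); last first.
  rewrite big1// => j _.
  by rewrite (warped_riemann_ffbb _ _ _ _ Ux Ty) mulr0.
rewrite (_ : \sum_(d < p) christoffel G [r c] [r a] [r d] _ * _ = 0); last first.
  by rewrite big1// => d _; rewrite fb mulr0.
rewrite (_ : \sum_(j < m) christoffel G [r c] [r b] [l j] _ * _ =
    (a == c)%:R * (e y c b * \sum_h A i h x * pderiv h f x)); last first.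
  rewrite -(hess_grad oU sg pg sf i Ux) !mulr_sumr; apply: eq_bigr => j _.
  rewrite (warped_riemann_fbfb _ _ _ _ Ux Ty).
  by rewrite (warped_christoffel Ux Ty); field.
rewrite (_ : \sum_(d < p) christoffel G [r c] [r b] [r d] _ * _ = 0); last first.
  by rewrite big1// => d _; rewrite fb mulr0.
rewrite (_ : \sum_(j < m) christoffel G [r c] [l j] [r c] _ * _ =
    e y a b * \sum_h A i h x * pderiv h f x); last first.
  rewrite mulr_sumr; apply: eq_bigr => j _.
  by rewrite (warped_christoffel Ux Ty) bf eqxx mul1r; field.
rewrite (_ : \sum_(d < p) christoffel G [r c] [r d] [r c] _ * _ = 0); last first.
  by rewrite big1// => d _; rewrite fb mulr0.
ring.
Qed.

(** The coefficient p - 2 collects -1 from the base directions, and -1 and p from the two Hessian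
    terms of the fibre directions. *)
Lemma warped_div x y i a b : U x -> T y ->
  div_riemann G [l i] [r a] [r b] (row_mx x y) =
  e y a b * (f x * div_hess g f i x
    + (p%:R - 2) * (\sum_h A i h x * pderiv h f x)
    - (p%:R - 1) * Q x * (pderiv i f x / f x))
  + pderiv i f x / f x * ricci e y a b.
Proof.
move=> Ux Ty; rewrite /div_riemann big_split_ord/=.
rewrite (eq_bigr _ (fun h _ => warped_cov_base i a b h Ux Ty)).
rewrite (eq_bigr _ (fun c _ => warped_cov_fibre i a b c Ux Ty)).
rewrite -mulr_sumr sumrB -mulr_sumr -/(div_hess g f i x).
rewrite (_ : \sum_h pderiv h f x * A i h x = \sum_h A i h x * pderiv h f x);
  last by apply: eq_bigr => h _; rewrite mulrC.
set S := \sum_h A i h x * pderiv h f x.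
rewrite big_split/= sumrB sumrN -mulr_sumr sumrB -mulr_sumr sumrB !sum_delta.
rewrite !sumr_const card_ord.
rewrite (_ : \sum_c riemann e c a b c y = - ricci e y a b); first ring.
by rewrite mxE -sumrN; apply: eq_bigr => c _; exact: riemann_antisym.
Qed.

Lemma warped_ricci_fb x y i a : U x -> T y ->
  ricci G (row_mx x y) [l i] [r a] = 0.
Proof.
move=> Ux Ty; rewrite mxE big_split_ord/= !big1 ?addr0// => k _.
  exact: (warped_riemann_fbbb).
exact: (warped_riemann_ffbf).
Qed.

Lemma warped_ricci_bb x y a b : U x -> T y ->
  ricci G (row_mx x y) [r a] [r b] = ricci e y a b
  - (f x * (\sum_h A h h x) + (p%:R - 1) * Q x) * e y a b.
Proof.
move=> Ux Ty; rewrite mxE big_split_ord/=.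
under eq_bigr do rewrite riemann_antisym
  (warped_riemann_fbbf _ _ _ _ Ux Ty).
under [X in _ + X]eq_bigr do rewrite riemann_antisym
  (warped_riemann_bbbb _ _ _ _ Ux Ty).
rewrite !sumrN sumrB -mulr_suml -!mulr_sumr sumrB sum_delta.
under [X in _ - (_ - _ * (_ - X))]eq_bigr do rewrite eqxx mul1r.
rewrite sumr_const card_ord.
rewrite (_ : \sum_c riemann e c a b c y = - ricci e y a b); first ring.
by rewrite mxE -sumrN; apply: eq_bigr => c _; exact: riemann_antisym.
Qed.

Lemma warped_ricci_few_eigenvalues x y (rho : R) (s : (m + p).-tuple R) :
  (1 < p)%N -> U x -> T y -> ricci e y = rho *: e y ->
  all (eigenvalue (ricci_endo G (row_mx x y))) s -> ~~ uniq s.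
Proof.
move=> p1 Ux Ty ein alls; apply/negP => us.
pose lam := rho - (f x * (\sum_h A h h x) + (p%:R - 1) * Q x).
(* Row vectors are acted on from the right, so a vanishing upper right block is what makes the last
   p coordinates evolve on their own. *)
have ricE : ricci G (row_mx x y) =
    block_mx (ulsubmx (ricci G (row_mx x y))) 0
             (dlsubmx (ricci G (row_mx x y))) (lam *: e y).
  rewrite -[LHS]submxK; congr block_mx; apply/matrixP => i j.
    transitivity (ricci G (row_mx x y) [l i] [r j]); first by rewrite !mxE.
    by rewrite (warped_ricci_fb _ _ Ux Ty) mxE.
  transitivity (ricci G (row_mx x y) [r i] [r j]); first by rewrite !mxE.
  by rewrite (warped_ricci_bb _ _ Ux Ty) ein !mxE -mulrBl.
have [ue f0] := (gram_unit pe Ty, f_gt0 Ux).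
pose mu := lam / f x ^+ 2.
have endoE : exists (M1 : 'M[R]_m) (M2 : 'M[R]_(p, m)),
    ricci_endo G (row_mx x y) = block_mx M1 0 M2 mu%:M.
  rewrite /ricci_endo (warped_gram_inv Ux Ty) ricE mulmx_block.
  do 2 eexists; congr block_mx; first by rewrite mulmx0 mul0mx addr0.
  rewrite mulmx0 add0r -scalemxAl -scalemxAr mulmxV// scalerA.
  by rewrite scalemx1.
move: endoE => [M1 [M2 endoE]].
(* Every eigenvalue is a root of [P]: either it is [mu], or the fibre part of an eigenvector
   vanishes and the base part is an eigenvector of [M1]. The degree is m + 1, less than m + p. *)
pose P := char_poly M1 * ('X - mu%:P).
have P0 : P != 0.
  by rewrite mulf_neq0// ?polyXsubC_eq0// monic_neq0// char_poly_monic.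
have rs : all (root P) s.
  apply/allP => t ts; have /eigenvalueP[v] := allP alls t ts.
  rewrite endoE -[v]hsubmxK mul_row_block scale_row_mx mulmx0 add0r.
  move=> /eq_row_mx[e1 e2] v0; rewrite rootM root_XsubC.
  have [->|tmu] := eqVneq t mu; first by rewrite orbT.
  have v2 : rsubmx v = 0.
    move: e2; rewrite mul_mx_scalar => /eqP; rewrite -subr_eq0 -scalerBl.
    by rewrite scaler_eq0 subr_eq0 eq_sym (negPf tmu) => /eqP.
  rewrite orbF -eigenvalue_root_char; apply/eigenvalueP; exists (lsubmx v).
    by rewrite -e1 v2 mul0mx addr0.
  by apply: contraNneq v0 => v1; rewrite v1 v2 row_mx0.
have := max_poly_roots P0 rs us.
rewrite size_tuple /P size_Mmonic ?monicXsubC//; last first.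
  by rewrite monic_neq0// char_poly_monic.
rewrite size_char_poly size_XsubC addn2/= !ltnS leqNgt => /negP; apply.
by rewrite -[m.+1]addn1 ltn_add2l.
Qed.

End WarpedProduct.

(** * Gradients on a Riemannian manifold *)

Lemma Cinf_differentiable_rV (R : realType) n k (U : set 'rV[R]_n)
    (tau : 'rV[R]_n -> 'rV[R]_k) x :
  open U -> U x -> Cinf U tau -> differentiable tau x.
Proof.
move=> oU Ux st.
have -> : tau = \sum_j (fun u => tau u 0 j *: delta_mx 0 j).
  by apply/funext => u; rewrite fct_sumE [LHS]row_sum_delta.
apply: differentiable_sum => j; apply: differentiableZl.
have stj : Cinf U (fun u => tau u 0 j) := Cinf_mx 0 j oU st.
exact: (C1_diff oU Ux (stj 1%N)).1.
Qed.

Lemma pderiv_comp (R : realType) n k (U : set 'rV[R]_n) (V : set 'rV[R]_k)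
    (tau : 'rV[R]_n -> 'rV[R]_k) (f : 'rV[R]_k -> R) x i :
  open U -> open V -> U x -> V (tau x) -> Cinf U tau -> Cinf V f ->
  pderiv i (f \o tau) x = \sum_j 'J tau x i j * pderiv j f (tau x).
Proof.
move=> oU oV Ux Vx st sf.
have dt := Cinf_differentiable_rV oU Ux st.
have [df dfE] := C1_diff oV Vx (sf 1%N).
rewrite /pderiv deriveE; last exact: differentiable_comp.
rewrite diff_comp//= dfE; apply: eq_bigr => j _; congr (_ * _).
by rewrite /jacobian mxE.
Qed.

Lemma posdef_inv (R : realType) n (G : 'M[R]_n) : posdef G -> posdef (invmx G).
Proof.
move=> pG; have [uG _] := posdef_invmx pG; have [sG pos] := pG.
split=> [|v v0]; first by rewrite trmx_inv sG.
have -> : v *m invmx G *m v^T = (v *m invmx G) *m G *m (v *m invmx G)^T.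
  by rewrite trmx_mul trmx_inv sG mulmxKV// mulmxA.
apply: pos; apply: contra_neq v0 => /(congr1 (mulmx^~ G)).
by rewrite mulmxKV// mul0mx.
Qed.

(** The transformation rule of the inverse metric under a change of chart. *)
Lemma invmx_congr (R : comUnitRingType) n (J H : 'M[R]_n) :
  J \in unitmx -> H \in unitmx ->
  J^T *m invmx (J *m H *m J^T) *m J = invmx H.
Proof.
move=> uJ uH; have uJT : J^T \in unitmx by rewrite unitmx_tr.
have uK : J *m H *m J^T \in unitmx by rewrite !unitmx_mul uJ uH.
rewrite -[RHS]mul1mx; apply: (canRL (mulmxK uH)).
move: uK; set K := J *m H *m J^T => uK; rewrite -!mulmxA.
by rewrite -[J *m H](mulmxK uJT) -/K mulKmx// mulmxV.
Qed.

(** Matrix form, to which the transformation rules of covectors and of the metric apply directly. *)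
Lemma grad_sqE (R : realType) n (g : 'rV[R]_n -> 'M[R]_n) f x :
  let d := \row_j pderiv j f x in
  grad_sq g f x = (d *m (invmx (g x))^T *m d^T) 0 0.
Proof.
move=> d; rewrite [RHS]mxE; apply: eq_bigr => h _; rewrite !mxE; congr (_ * _).
by apply: eq_bigr => k _; rewrite !mxE mulrC.
Qed.

Lemma pderiv_eq0_cst (R : realType) n (U : set 'rV[R]_n)
    (f : 'rV[R]_n -> R) x :
  open U -> U x -> Cinf U f -> (forall i y, U y -> pderiv i f y = 0) ->
  \forall y \near x, f y = f x.
Proof.
move=> oU Ux sf d0.
have /nbhs_ballP[r /= r0 rU] : nbhs x U by exact: open_nbhs_nbhs.
apply/nbhs_ballP; exists r => //= y yr.
have inU t : 0 <= t <= 1 -> U (x + t *: (y - x)).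
  move=> /andP[t0 t1]; apply: rU; move: yr; rewrite -!ball_normE/=.
  rewrite opprD addrA subrr sub0r normrN normrZ ger0_norm// distrC.
  by apply: le_lt_trans; rewrite ler_piMl.
have [|t /andP[t0 t1]] := @MVT_line _ _ f x (y - x) 0 1 ltr01.
  by move=> t tI; exact: (deriveE_pderiv _ oU (inU t tI) (sf 1%N)).1.
have Ut : U (x + t *: (y - x)) by apply: inU; rewrite !ltW.
rewrite (deriveE_pderiv _ oU Ut (sf 1%N)).2 big1 ?mulr0; last first.
  by move=> i _; rewrite d0// mulr0.
rewrite scale1r scale0r addr0 [x + (y - x)]addrC subrK => /eqP.
by rewrite subr_eq0 => /eqP.
Qed.

Section Manifold.
Variables (R : realType) (m : nat) (B : riemannian R m).
Hypothesis hB : is_riemannian B.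
Implicit Types (a b : chart_index B) (u : 'rV[R]_m) (x : B).

Let is_chartB a : is_chart (chart_of a) :=
  (let: conj (conj _ (And3 H _ _)) _ := hB in H) a.

Lemma chart_img_open a : open (chart_img (chart_of a)).
Proof. by case: (is_chartB a). Qed.

Lemma chart_dom_open a : open (chart_dom (chart_of a)).
Proof. by case: (is_chartB a). Qed.

Lemma chart_coordP a x : chart_dom (chart_of a) x ->
  [/\ chart_img (chart_of a) (chart_coord (chart_of a) x),
      chart_param (chart_of a) (chart_coord (chart_of a) x) = x
    & {for x, continuous (chart_coord (chart_of a))}].
Proof. by case: (is_chartB a) => _ _ + _; exact. Qed.

Lemma chart_paramP a u : chart_img (chart_of a) u ->
  [/\ chart_dom (chart_of a) (chart_param (chart_of a) u),
      chart_coord (chart_of a) (chart_param (chart_of a) u) = u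
    & {for u, continuous (chart_param (chart_of a))}].
Proof. by case: (is_chartB a) => _ _ _; exact. Qed.

Lemma chart_cover x : exists a, chart_dom (chart_of a) x.
Proof. by case: hB => -[_ [_ H _]] _; exact: H. Qed.

Lemma overlap_open a b : open (overlap a b).
Proof.
rewrite openE => u [iu du]; apply: filterI.
  by apply: open_nbhs_nbhs; split => //; exact: chart_img_open.
have [_ _] := chart_paramP iu; apply.
by apply: open_nbhs_nbhs; split => //; exact: chart_dom_open.
Qed.

Lemma Cinf_transition a b : Cinf (overlap a b) (transition a b).
Proof. by apply: smooth_on_Cinf; case: hB => -[_ [_ _ H]] _; exact: H. Qed.

Lemma Cinf_gram a i j : Cinf (chart_img (chart_of a)) (fun u => gram a u i j).
Proof.
apply: Cinf_mx; first exact: chart_img_open.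
by apply: smooth_on_Cinf; case: hB => _ [H _ _ _]; exact: H.
Qed.

Lemma posdef_gram a u : chart_img (chart_of a) u -> posdef (gram a u).
Proof. by case: hB => _ [_ H1 H2 _] iu; split; [exact: H1|exact: H2]. Qed.

Lemma gram_transition a b u : overlap a b u ->
  gram a u = 'J (transition a b) u *m gram b (transition a b u)
             *m ('J (transition a b) u)^T.
Proof. by case: hB => _ [_ _ _ H]; exact: H. Qed.

Variable phi : B -> R.
Hypothesis phi_smooth : smooth_fun phi.

Definition local_rep a := phi \o chart_param (chart_of a).

Lemma Cinf_local_rep a : Cinf (chart_img (chart_of a)) (local_rep a).
Proof. by apply: smooth_on_Cinf; exact: phi_smooth. Qed.

Lemma local_rep_transition a b u : overlap a b u ->
  local_rep a u = local_rep b (transition a b u).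
Proof.
by move=> [_ /= /chart_coordP[_ e _]]; rewrite /local_rep /transition /= e.
Qed.

Lemma grad_sq_transition a b u : overlap a b u ->
  grad_sq (gram a) (local_rep a) u =
  grad_sq (gram b) (local_rep b) (transition a b u).
Proof.
move=> ou; have [iu du] := ou; have [ib _ _] := chart_coordP du.
rewrite -[chart_coord _ _]/(transition a b u) in ib.
set J := 'J (transition a b) u.
pose da := \row_j pderiv j (local_rep a) u.
pose db := \row_j pderiv j (local_rep b) (transition a b u).
have dE : da = db *m J^T.
  apply/rowP => i; rewrite !mxE.
  rewrite (pderiv_ext i (@overlap_open a b) ou (@local_rep_transition a b)).
  rewrite (pderiv_comp i (@overlap_open a b) (@chart_img_open b) ou ib
    (@Cinf_transition a b) (@Cinf_local_rep b)).
  by apply: eq_bigr => j _; rewrite !mxE mulrC.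
have [ua _] := posdef_invmx (posdef_gram iu).
have [ub _] := posdef_invmx (posdef_gram ib).
have gE := gram_transition ou; rewrite -/J in gE.
(* Invertibility of the Jacobian is read off the transformation rule of the metric. *)
have uJ : J \in unitmx.
  by move: ua; rewrite gE !unitmx_mul => /andP[/andP[]].
rewrite !grad_sqE -/da -/db.
suff -> : da *m (invmx (gram a u))^T *m da^T =
  db *m (invmx (gram b (transition a b u)))^T *m db^T by [].
rewrite dE trmx_mul trmxK gE !trmx_inv.
rewrite (posdef_gram ib).1 !trmx_mul trmxK (posdef_gram ib).1.
by rewrite -(invmx_congr uJ ub) !mulmxA.
Qed.

Hypothesis phi_nonconstant : exists x y, phi x <> phi y.

(** Otherwise [phi] is locally constant, so a level set is open and closed in a connected space. *)
Lemma exists_pderiv_neq0 : exists a u i,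
  chart_img (chart_of a) u /\ pderiv i (local_rep a) u != 0.
Proof.
apply: contrapT => no; case: phi_nonconstant => x0 [y0]; apply.
have d0 a u i : chart_img (chart_of a) u -> pderiv i (local_rep a) u = 0.
  by move=> iu; apply: contrapT => /eqP ne; apply: no; exists a, u, i.
have loc x : \forall y \near x, phi y = phi x.
  have [a ax] := chart_cover x; have [ix px cx] := chart_coordP ax.
  have := pderiv_eq0_cst (@chart_img_open a) ix (@Cinf_local_rep a)
    (fun i u => d0 a u i).
  rewrite /local_rep /= px => /cx /= near_x.
  have dx : \forall y \near x, chart_dom (chart_of a) y.
    by apply: open_nbhs_nbhs; split => //; exact: chart_dom_open.
  near=> y; have /chart_coordP[_ <- _] : chart_dom (chart_of a) y by near: y.
  by near: y; exact: near_x.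
have [[_ _ _ con] _] := hB.1.
have := con [set x | phi x = phi x0] _ _ _.
move=> H; have {}H : [set x | phi x = phi x0] = setT.
  apply: H; first by exists x0.
  - exists [set x | phi x = phi x0]; last by rewrite setTI.
    rewrite openE => x xE; have := loc x; apply: filterS => y /= ->.
    exact: xE.
  - exists [set x | phi x = phi x0]; last by rewrite setTI.
    rewrite -openC openE => x /= xE; have := loc x; apply: filterS => y /= ->.
    exact: xE.
by have : [set x | phi x = phi x0] y0 by rewrite H.
Unshelve. all: by end_near. Qed.

Lemma smooth_fun_continuous : continuous phi.
Proof.
move=> x; have [a ax] := chart_cover x; have [ix px cx] := chart_coordP ax.
apply: (@near_eq_continuous _ _
  (local_rep a \o chart_coord (chart_of a)) phi x).
  have : \forall y \near x, chart_dom (chart_of a) y.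
    by apply: open_nbhs_nbhs; split => //; exact: chart_dom_open.
  by apply: filterS => y /chart_coordP[_ py _]; rewrite /local_rep /= py.
apply: continuous_comp; first exact: cx.
exact: Cinf_continuous (Cinf_local_rep a) ix.
Qed.

(** The chart at [x] is picked by choice; [grad_sq_transition] makes the value independent of it. *)
Definition global_grad_sq x : R :=
  let a := projT1 (cid (chart_cover x)) in
  grad_sq (gram a) (local_rep a) (chart_coord (chart_of a) x).

Lemma global_grad_sqE a u : chart_img (chart_of a) u ->
  global_grad_sq (chart_param (chart_of a) u) =
  grad_sq (gram a) (local_rep a) u.
Proof.
move=> iu; rewrite /global_grad_sq; case: cid => b /= bx.
by rewrite (@grad_sq_transition a b u).
Qed.

Lemma global_grad_sq_continuous : continuous global_grad_sq.
Proof.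
move=> x; have [a ax] := chart_cover x; have [ix px cx] := chart_coordP ax.
apply: (@near_eq_continuous _ _
  (grad_sq (gram a) (local_rep a) \o chart_coord (chart_of a))
  global_grad_sq x).
  have : \forall y \near x, chart_dom (chart_of a) y.
    by apply: open_nbhs_nbhs; split => //; exact: chart_dom_open.
  apply: filterS => y /chart_coordP[iy py _].
  by rewrite /= -global_grad_sqE// py.
apply: continuous_comp; first exact: cx.
apply: (Cinf_continuous (U := chart_img (chart_of a))) => //.
apply: Cinf_grad_sq; [exact: chart_img_open|exact: Cinf_gram
  |exact: posdef_gram|exact: Cinf_local_rep].
Qed.

Lemma grad_sq_gt0 a u i : chart_img (chart_of a) u ->
  pderiv i (local_rep a) u != 0 -> 0 < grad_sq (gram a) (local_rep a) u.
Proof.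
move=> iu d0; have pg := posdef_inv (posdef_gram iu).
rewrite grad_sqE pg.1; apply: pg.2; apply: contra_neq d0 => /rowP/(_ i).
by rewrite !mxE.
Qed.

Hypothesis B_compact : compact [set: B].
Hypothesis phi_gt0 : forall x, 0 < phi x.

(* [weighted_grad_sq_no_max] rules out such a point when kappa <= 0; C is chosen
   after bounding phi on the compact base.                                    *)
Lemma exists_weighted_max : exists a u C,
  [/\ chart_img (chart_of a) u, 0 < grad_sq (gram a) (local_rep a) u,
      (6 + 3 / 8 * m%:R) * local_rep a u ^+ 3 < C
    & forall v, chart_img (chart_of a) v ->
        grad_sq (gram a) (local_rep a) v * (C + local_rep a v ^+ 3) <=
        grad_sq (gram a) (local_rep a) u * (C + local_rep a u ^+ 3)].
Proof.
have [a0 [u0 [i0 [iu0 d0]]]] := exists_pderiv_neq0.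
have B0 : [set: B] !=set0 by exists (chart_param (chart_of a0) u0).
have [z _ zmax] := compact_EVT_max B0 B_compact
  (continuous_subspaceT smooth_fun_continuous).
(* [z] maximizes [phi], so one constant works at every point; the summand 1 makes the bound
   strict. *)
pose k : R := 6 + 3 / 8 * m%:R; pose C := k * phi z ^+ 3 + 1.
have k0 : 0 < k by rewrite ltr_wpDr// mulr_ge0.
have phi_C x : k * phi x ^+ 3 < C.
  rewrite /C ltr_pwDr// ler_pM2l// lerXn2r ?nnegrE ?(ltW (phi_gt0 _))//.
  by apply: zmax; exact: in_setT.
have C0 : 0 < C by apply: lt_trans (phi_C z); rewrite mulr_gt0// exprn_gt0.
pose w x := global_grad_sq x * (C + phi x ^+ 3).
have cw : continuous w.
  move=> x; apply: continuousM; first exact: global_grad_sq_continuous.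
  apply: continuousD; first exact: cst_continuous.
  apply: (@continuous_comp _ _ _ phi (fun t => t ^+ 3)).
    exact: smooth_fun_continuous.
  exact: exprn_continuous.
have [x _ xmax] := compact_EVT_max B0 B_compact (continuous_subspaceT cw).
have [a ax] := chart_cover x; have [ix px _] := chart_coordP ax.
have wE v : chart_img (chart_of a) v -> w (chart_param (chart_of a) v) =
    grad_sq (gram a) (local_rep a) v * (C + local_rep a v ^+ 3).
  by move=> iv; rewrite /w global_grad_sqE.
have pos y : 0 < C + phi y ^+ 3 by rewrite addr_gt0// exprn_gt0.
exists a, (chart_coord (chart_of a) x), C; split => //.
(* The maximum is at least the value at a point where d phi is nonzero; as the weight is positive,
   so is Q at the maximum. *)
- have : 0 < w x.
    apply: lt_le_trans (xmax (chart_param (chart_of a0) u0) _); rewrite ?inE//.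
    by rewrite /w global_grad_sqE// mulr_gt0//; exact: grad_sq_gt0 d0.
  rewrite -{1}px wE// pmulr_lgt0//.
  exact: (pos (chart_param (chart_of a) (chart_coord (chart_of a) x))).
- exact: (phi_C (chart_param (chart_of a) (chart_coord (chart_of a) x))).
- move=> v iv; rewrite -!wE// px; apply: xmax; exact: in_setT.
Qed.

End Manifold.

(** * Harmonic curvature *)

(** With a single index, the two slots in which the curvature is antisymmetric coincide. *)
Lemma ricci_dim1 (R : realType) n (g : 'rV[R]_n -> 'M[R]_n) x :
  n = 1%N -> ricci g x = 0.
Proof.
move=> n1; move: g x; rewrite n1 => g x.
apply/matrixP => i j; rewrite mxE big_ord1 !ord1 mxE /riemann subrr add0r.
by rewrite big1// => q _; rewrite subrr.
Qed.

Section Main.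
Variables (R : realType) (m p : nat) (B : riemannian R m) (F : riemannian R p).
Variable phi : B -> R.
Hypotheses (hB : is_riemannian B) (hF : is_riemannian F).
Hypotheses (phi_smooth : smooth_fun phi) (phi_gt0 : forall x : B, 0 < phi x).
Hypothesis hharm : harmonic_curvature (warped_product B F phi).

Local Notation f := (local_rep phi).

(** The formula of [warped_div] multiplied by [phi], which clears its denominators. *)
Lemma harmonic_mixed (a : chart_index B) (b : chart_index F) x y i c d :
  chart_img (chart_of a) x -> chart_img (chart_of b) y ->
  gram b y c d * (f a x ^+ 2 * div_hess (gram a) (f a) i x
    + (p%:R - 2) * f a x
      * (\sum_h hess_endo (gram a) (f a) i h x * pderiv h (f a) x)
    - (p%:R - 1) * grad_sq (gram a) (f a) x * pderiv i (f a) x)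
  + pderiv i (f a) x * ricci (gram b) y c d = 0.
Proof.
move=> ix iy; have f0 : f a x != 0 by rewrite gt_eqF// phi_gt0.
have du := warped_div (@chart_img_open _ _ _ hB a) (Cinf_gram hB a)
  (@posdef_gram _ _ _ hB a) (Cinf_local_rep phi_smooth a)
  (fun x _ => phi_gt0 (chart_param (chart_of a) x))
  (@chart_img_open _ _ _ hF b) (Cinf_gram hF b)
  (@posdef_gram _ _ _ hF b) i c d ix iy.
have : div_riemann (warped_gram (gram a) (f a) (gram b)) (lshift p i)
    (rshift m c) (rshift m d) (row_mx x y) = 0.
  by apply: (hharm (a := (a, b))); rewrite /= row_mxKl row_mxKr.
rewrite du => /(congr1 ( *%R (f a x))); rewrite mulr0 => eq0; rewrite -[RHS]eq0.
by field.
Qed.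

Lemma fibre_gram_gt0 (b : chart_index F) y c :
  chart_img (chart_of b) y -> 0 < gram b y c c.
Proof.
move=> iy; have [_ pos] := posdef_gram hF iy.
have /pos : delta_mx 0 c != 0 :> 'rV[R]_p.
  by apply/eqP => /rowP/(_ c)/eqP; rewrite !mxE !eqxx oner_eq0.
by rewrite -rowE mxE (bigD1 c)//= big1 => [|j jc];
  rewrite !mxE ?eqxx ?mulr1 ?addr0// (negPf jc) andbF mulr0.
Qed.

Lemma exists_fibre_chart :
  exists (b : chart_index F) y, chart_img (chart_of b) y.
Proof.
have [[[_ _ [z _] _] _] _] := hF; have [b bz] := chart_cover hF z.
by have [iz _ _] := chart_coordP hF bz; exists b, (chart_coord (chart_of b) z).
Qed.

Hypothesis phi_nonconstant : exists x y : B, phi x <> phi y.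

Lemma fibre_einstein : exists kappa : R, einstein_constant F kappa.
Proof.
have [a [x [i [ix d0]]]] := exists_pderiv_neq0 hB phi_smooth phi_nonconstant.
pose c := f a x ^+ 2 * div_hess (gram a) (f a) i x
    + (p%:R - 2) * f a x
      * (\sum_h hess_endo (gram a) (f a) i h x * pderiv h (f a) x)
    - (p%:R - 1) * grad_sq (gram a) (f a) x * pderiv i (f a) x.
(* Base point and index are fixed, so this number is the same for all points and charts of the
   fibre. *)
exists (- c / pderiv i (f a) x) => b y iy; apply/matrixP => k l.
have /eqP := harmonic_mixed i k l ix iy; rewrite -/c addr_eq0 => /eqP e.
by rewrite [RHS]mxE; apply: (mulfI d0); rewrite -[LHS]opprK -e; field.
Qed.

Lemma fibre_einstein_gt0 (hcompact : compact [set: B]) (hp : (0 < p)%N) kappa :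
  einstein_constant F kappa -> 0 < kappa.
Proof.
move=> ein; rewrite ltNge; apply/negP => k0.
have [a [x [C [ix Q0 Cgt mx]]]] :=
  exists_weighted_max hB phi_smooth phi_nonconstant hcompact phi_gt0.
have [b [y iy]] := exists_fibre_chart.
apply: (weighted_grad_sq_no_max (@chart_img_open _ _ _ hB a)
  (Cinf_gram hB a) (@posdef_gram _ _ _ hB a)
  (Cinf_local_rep phi_smooth a) _ ix _ Q0 hp k0 Cgt mx) => [i|]; last first.
  exact: phi_gt0.
(* A diagonal entry of the fibre metric is positive and can be cancelled, which leaves the scalar
   equation on the base. *)
have c : 'I_p := Ordinal hp.
have ec := fibre_gram_gt0 c iy.
have := harmonic_mixed i c c ix iy; rewrite (ein b y iy) mxE mulrA.
rewrite [X in _ + X]mulrC -mulrDr => /eqP; rewrite mulf_eq0 gt_eqF//= => /eqP e.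
apply/eqP; rewrite -subr_eq0; apply/eqP; rewrite -[RHS]e; ring.
Qed.

End Main.

Theorem theorem1p4 (R : realType) (m p : nat)
    (B : riemannian R m) (F : riemannian R p) (phi : B -> R)
    (hB : is_riemannian B) (hF : is_riemannian F)
    (hcompact : compact [set: B]) (hp : (1 <= p)%N)
    (phi_smooth : smooth_fun phi) (phi_gt0 : forall x : B, 0 < phi x)
    (phi_nonconstant : exists x y : B, phi x <> phi y)
    (hharm : harmonic_curvature (warped_product B F phi)) :
  [/\ exists kappa : R, einstein_constant F kappa,
      forall kappa : R, einstein_constant F kappa -> 0 < kappa,
      (1 < p)%N
    & ~ exists x : warped_product B F phi, ricci_distinct_at x].
Proof.
have [kappa ein] :=
  fibre_einstein hB hF phi_smooth phi_gt0 hharm phi_nonconstant.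
have kpos k : einstein_constant F k -> 0 < k :=
  @fibre_einstein_gt0 _ _ _ _ _ _ hB hF phi_smooth phi_gt0 hharm
    phi_nonconstant hcompact hp k.
have p1 : (1 < p)%N.
  rewrite ltn_neqAle hp andbT; apply/eqP => p1.
  (* A one-dimensional fibre is Ricci flat, so 0 would be an Einstein constant, against
     positivity. *)
  have : einstein_constant F 0.
    by move=> b y _; rewrite scale0r; exact: ricci_dim1.
  by move=> /kpos; rewrite ltxx.
split=> //; first by exists kappa.
move=> [x [[a b] /= [xa xb] [s [us alls]]]].
have [ix _ _] := chart_coordP hB xa; have [iy _ _] := chart_coordP hF xb.
have := @warped_ricci_few_eigenvalues R m p _ _ (gram a) (local_rep phi a)
  (gram b) (@chart_img_open _ _ _ hB a) (Cinf_gram hB a)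
  (@posdef_gram _ _ _ hB a) (Cinf_local_rep phi_smooth a)
  (fun x _ => phi_gt0 (chart_param (chart_of a) x))
  (@chart_img_open _ _ _ hF b) (Cinf_gram hF b)
  (@posdef_gram _ _ _ hF b) _ _ _ s p1 ix iy (ein _ _ iy) alls.
by rewrite us.
Qed.
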